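(* Let $q\in\mathbb C$ be non-zero and not a root of unity, $\alpha\in\mathbb C$ irrational, and let $L=(\mathbb C(t,t^\alpha),\sigma,\theta^* )$, $k=\mathbb C$ be the $q$-skew iterative $\sigma$-differential field extension described in the context. There is an injection, functorial in $A\in(NCAlg/L^\natural)$, $$\mathcal{NCF}_{L/k}(A)\hookrightarrow\widehat{QG}_{II,q}(A),\qquad \varphi\mapsto\left(\begin{bmatrix}e&f\\0&1\end{bmatrix},\,b_0(W_1)\right),$$ where $e,f\in A$ and $b_0(W_1)\in A[[W_1]]$ are determined by $$\varphi(Q)=eQ,\qquad \varphi(X)=X+fQ,\qquad \varphi(Y_0)=\sum_{n=0}^\infty X^n\binom{\alpha}{n}_q\bigl(e(t+W_1)+f\bigr)^{-n}Q^{\alpha-n}b_0(W_1).$$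
   Context: All rings are associative and unital, and morphisms are unital. $\mathbb N=\{0,1,2,\dots\}$. $(NCAlg/R)$ is the category of not necessarily commutative $R$-algebras in which the image of the commutative ring $R$ is central. $[n]_q=1+q+\dots+q^{n-1}$, $[n]_q!=\prod_{i=1}^n[i]_q$, $\binom{m}{n}_q=\frac{[m]_q!}{[m-n]_q!\,[n]_q!}$ for integers $m\ge n\ge 0$. A value $q^\alpha$ is fixed; for $\beta=\alpha+m$, $m\in\mathbb Z$, $q^\beta=q^\alpha q^m$, $[\beta]_q=\frac{q^\beta-1}{q-1}$, and $\binom{\alpha}{n}_q=\frac{[\alpha]_q[\alpha-1]_q\cdots[\alpha-n+1]_q}{[n]_q!}$. The field. $L=\mathbb C(t,y)$ with $y=t^\alpha$; $t,y$ are algebraically independent over $\mathbb C$. $\sigma$ is the $\mathbb C$-automorphism with $\sigma(t)=qt$, $\sigma(y)=q^\alpha y$; $\theta^{(0)}=\mathrm{Id}$, $\theta^{(1)}(a)=\frac{\sigma(a)-a}{(q-1)t}$, $\theta^{(n)}=\frac1{[n]_q!}(\theta^{(1)})^n$. $L^\natural$ is the abstract field $\mathbb C(t,y)$. Twisted power series. For a ring $B$, $F(\mathbb N,B)$ is the ring of functions $\mathbb N\to B$ with pointwise operations and shift $(\Sigma f)(n)=f(n+1)$. $F(\mathbb N,B)[[X]]$ is the ring of formal series $\sum_{i\ge0}X^ia_i$, $a_i\in F(\mathbb N,B)$, with $aX=X\Sigma(a)$. On it, $\hat\Sigma(\sum X^ia_i)=\sum X^iq^i\Sigma(a_i)$ and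 $\hat\Theta^{(l)}(\sum X^ia_i)=\sum X^i\binom{i+l}{l}_qa_{i+l}$. Elements of $B$ are identified with constant functions. For $\beta\in\mathbb Z\cup(\alpha+\mathbb Z)$, $Q^\beta\in F(\mathbb N,\mathbb C)$ is $n\mapsto (q^{\beta})^n$, and $Q=Q^1$. Galois hull. $\iota:L\to F(\mathbb N,L^\natural)[[X]]$, $\iota(a)=\sum_{i\ge0}X^iu[\theta^{(i)}(a)]$, $u[b](n)=\sigma^n(b)$. One has $\iota(t)=tQ+X$ and $\iota(y)=Y_0y$ with $Y_0=\sum_{n\ge0}X^n\binom{\alpha}{n}_qt^{-n}Q^{\alpha-n}$. The Galois hull $\mathcal L$ is the smallest subring of $F(\mathbb N,L^\natural)[[X]]$ containing $\iota(L)$ and $L^\natural$ (constant functions) and stable under $\hat\Sigma$, all $\hat\Theta^{(l)}$, $\partial/\partial t$ and $\partial/\partial y$ (acting on the values of the coefficients); $\mathcal K=L^\natural$ (constant functions). Deformation functor. For $A\in(NCAlg/L^\natural)$, the map $L^\natural\to A[[W_1,W_2]]$, $a\mapsto\sum_{i,j}\frac1{i!j!}\frac{\partial^{i+j}a}{\partial t^i\partial y^j}W_1^iW_2^j$ ($W_1,W_2$ central variables), applied to coefficients gives $\iota_A:\mathcal L\to F(\mathbb N,A[[W_1,W_2]])[[X]]$. $\mathcal{NCF}_{L/k}(A)$ is the set of ring morphisms $\varphi:\mathcal L\to F(\mathbb N,A[[W_1,W_2]])[[X]]$ commuting with $\hat\Sigma$ and all $\hat\Theta^{(l)}$, intertwining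 $\partial/\partial t,\partial/\partial y$ with $\partial/\partial W_1,\partial/\partial W_2$, equal to $\iota_A$ on $\mathcal K$, and congruent to $\iota_A$ modulo nilpotent elements (for each $x\in\mathcal L$, all coefficients in $A$ of $\varphi(x)-\iota_A(x)$ are nilpotent). Target functor. $\widehat{QG}_{II,q}(A)$ is the set of pairs $\left(\begin{bmatrix}e&f\\0&1\end{bmatrix},b(W_1)\right)\in M_2(A)\times A[[W_1]]$ such that $ef=q^{-1}fe$, $e$ is invertible, $[e(t+W_1)+f,\,b(W_1)]=0$, and $e-1$, $f$ and all coefficients of $b(W_1)-1$ are nilpotent. Here $[x,y]=xy-yx$ and $t$ denotes its image in $A$. *)

(* Defs.v *)
From HB Require Import structures.
From mathcomp Require Import all_boot all_order all_algebra fraction.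
From mathcomp Require Import ring complex.
From mathcomp Require Import mathcomp_extra boolp classical_sets functions.
From mathcomp Require Import reals sequences exp trigo.

Set Implicit Arguments.
Unset Strict Implicit.
Unset Printing Implicit Defensive.

Import GRing.Theory.
Local Open Scope ring_scope.
Local Open Scope classical_set_scope.

(** [skew_series s] is the ring of formal series [\sum_i X^i a_i], with the
    coefficients on the right and the rule [a * X = X * s a].  The ring [B] may
    be the zero ring. *)

Record skew_series (B : pzRingType) (s : {rmorphism B -> B}) :=
  SkewSeries { coefs : nat -> B }.
Arguments SkewSeries {B} s coefs.

HB.instance Definition _ (B : pzRingType) (s : {rmorphism B -> B}) :=
  [isNew for @coefs B s].
HB.instance Definition _ (B : pzRingType) (s : {rmorphism B -> B}) :=
  [Choice of skew_series s by <:].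

Section SkewSeries.
Variables (B : pzRingType) (s : {rmorphism B -> B}).
Implicit Types x y z : skew_series s.

Lemma skew_seriesP x y : coefs x =1 coefs y -> x = y.
Proof. by move=> e; apply: val_inj; apply/funext. Qed.

Definition skew_zero := SkewSeries s (fun=> 0).
Definition skew_add x y := SkewSeries s (fun i => coefs x i + coefs y i).
Definition skew_opp x := SkewSeries s (fun i => - coefs x i).
Definition skew_one := SkewSeries s (fun i => (i == 0)%N%:R).
Definition skew_mul x y := SkewSeries s
  (fun i => \sum_(j < i.+1) iter j s (coefs x (i - j)%N) * coefs y j).

Fact skew_addA : associative skew_add.
Proof. by move=> x y z; apply: skew_seriesP => i; apply: addrA. Qed.
Fact skew_addC : commutative skew_add.
Proof. by move=> x y; apply: skew_seriesP => i; apply: addrC. Qed.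
Fact skew_add0 : left_id skew_zero skew_add.
Proof. by move=> x; apply: skew_seriesP => i; apply: add0r. Qed.
Fact skew_addN : left_inverse skew_zero skew_opp skew_add.
Proof. by move=> x; apply: skew_seriesP => i; apply: addNr. Qed.

HB.instance Definition _ :=
  GRing.isZmodule.Build (skew_series s) skew_addA skew_addC skew_add0 skew_addN.

Fact iter_is_zmod_morphism j : zmod_morphism (iter j s).
Proof. by move=> a b; elim: j => //= j ->; rewrite rmorphB. Qed.
Fact iter_is_monoid_morphism j : monoid_morphism (iter j s).
Proof.
by split=> [|a b]; elim: j => //= j ->; rewrite ?rmorph1 ?rmorphM.
Qed.
HB.instance Definition _ j :=
  GRing.isZmodMorphism.Build B B (iter j s) (iter_is_zmod_morphism j).
HB.instance Definition _ j :=
  GRing.isMonoidMorphism.Build B B (iter j s) (iter_is_monoid_morphism j).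

Fact skew_mulA : associative skew_mul.
Proof.
move=> x y z; apply: skew_seriesP => n /=.
pose F j k := iter j s (coefs x (n - j)) *
  (iter k s (coefs y (j - k)) * coefs z k).
transitivity (\sum_(j < n.+1) \sum_(k < n.+1 | (k <= j)%N) F j k).
  apply: eq_bigr => j _; rewrite mulr_sumr.
  rewrite (big_ord_widen n.+1 (F j)) ?ltn_ord //.
rewrite (exchange_big_dep xpredT) //=; apply: eq_bigr => k _.
have kn : (k <= n)%N by rewrite -ltnS.
rewrite rmorph_sum mulr_suml /=.
rewrite -(big_mkord (fun j => (k <= j)%N) (fun j => F j k)).
rewrite -(@big_nat_widenl _ _ _ k 0 n.+1 predT (F^~ k)) //=.
rewrite -{1}(add0n k) big_addn subSn // big_mkord; apply: eq_bigr => i _.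
rewrite /F rmorphM /= -iterD (addnC k) addnK mulrA.
by rewrite (addnC i) subnDA.
Qed.
Fact skew_mul1l : left_id skew_one skew_mul.
Proof.
move=> x; apply: skew_seriesP => n /=.
rewrite big_ord_recr /= subnn rmorph1 mul1r.
rewrite big1 ?add0r // => i _; rewrite subn_eq0 leqNgt ltn_ord.
by rewrite rmorph0 mul0r.
Qed.
Fact skew_mul1r : right_id skew_one skew_mul.
Proof.
move=> x; apply: skew_seriesP => n /=; rewrite big_ord_recl /= subn0 mulr1.
by rewrite big1 ?addr0 // => i _; rewrite mulr0.
Qed.
Fact skew_mulDl : left_distributive skew_mul skew_add.
Proof.
move=> x y z; apply: skew_seriesP => n /=; rewrite -big_split /=.
by apply: eq_bigr => i _; rewrite rmorphD mulrDl.
Qed.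
Fact skew_mulDr : right_distributive skew_mul skew_add.
Proof.
move=> x y z; apply: skew_seriesP => n /=; rewrite -big_split /=.
by apply: eq_bigr => i _; rewrite mulrDr.
Qed.

HB.instance Definition _ := GRing.Zmodule_isPzRing.Build (skew_series s)
  skew_mulA skew_mul1l skew_mul1r skew_mulDl skew_mulDr.

Definition skew_const (b : B) : skew_series s :=
  SkewSeries s (fun i => if i == 0%N then b else 0).
Definition skew_X : skew_series s := SkewSeries s (fun i => (i == 1)%N%:R).

End SkewSeries.

Arguments skew_const {B} s b.
Arguments skew_X {B} s.

Section SkewMap.
Variables (B B' : pzRingType) (s : {rmorphism B -> B}).
Variables (s' : {rmorphism B' -> B'}).

Definition skew_map (g : B -> B') (x : skew_series s) : skew_series s' :=
  SkewSeries s' (g \o coefs x).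

Lemma skew_map_is_zmod_morphism (g : {additive B -> B'}) :
  zmod_morphism (skew_map g).
Proof. by move=> x y; apply: skew_seriesP => i /=; rewrite raddfB. Qed.

Lemma skew_map_is_monoid_morphism (g : {rmorphism B -> B'}) :
  (forall b, g (s b) = s' (g b)) -> monoid_morphism (skew_map g).
Proof.
move=> gs; split=> [|x y]; apply: skew_seriesP => i /=.
  by rewrite rmorph_nat.
rewrite rmorph_sum; apply: eq_bigr => j _; rewrite rmorphM /=.
congr (_ * _); move: (coefs x _) => b.
by elim: (nat_of_ord j) => //= k <-; rewrite gs.
Qed.

End SkewMap.

Definition id_rmorph (B : pzRingType) : {rmorphism B -> B} :=
  GRing.RMorphism.clone B B idfun _.

Notation pseries B := (skew_series (id_rmorph B)).

Definition pmap (B B' : pzRingType) (g : B -> B') : pseries B -> pseries B' :=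
  skew_map (id_rmorph B') g.

HB.instance Definition _ (B B' : pzRingType) (g : {rmorphism B -> B'}) :=
  GRing.isZmodMorphism.Build (pseries B) (pseries B') (pmap g)
    (@skew_map_is_zmod_morphism _ _ (id_rmorph B) (id_rmorph B') g).
HB.instance Definition _ (B B' : pzRingType) (g : {rmorphism B -> B'}) :=
  GRing.isMonoidMorphism.Build (pseries B) (pseries B') (pmap g)
    (@skew_map_is_monoid_morphism _ _ (id_rmorph B) (id_rmorph B') g
       (fun=> erefl)).

Definition pconst (B : pzRingType) (b : B) : pseries B :=
  skew_const (id_rmorph B) b.

Definition deriv_series (B : pzRingType) (x : pseries B) : pseries B :=
  SkewSeries _ (fun i => coefs x i.+1 *+ i.+1).

(* [nat -> B] is the ring [F(N, B)], with pointwise operations. *)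
Definition shift (B : pzRingType) (f : nat -> B) : nat -> B :=
  fun n => f n.+1.

Fact shift_is_zmod_morphism (B : pzRingType) : zmod_morphism (@shift B).
Proof. by []. Qed.
Fact shift_is_monoid_morphism (B : pzRingType) : monoid_morphism (@shift B).
Proof. by []. Qed.
HB.instance Definition _ (B : pzRingType) := GRing.isZmodMorphism.Build
  (nat -> B) (nat -> B) (@shift B) (@shift_is_zmod_morphism B).
HB.instance Definition _ (B : pzRingType) := GRing.isMonoidMorphism.Build
  (nat -> B) (nat -> B) (@shift B) (@shift_is_monoid_morphism B).

Definition shift_rmorph (B : pzRingType) :
    {rmorphism (nat -> B) -> (nat -> B)} :=
  GRing.RMorphism.clone (nat -> B) (nat -> B) (@shift B) _.

Notation tseries B := (skew_series (shift_rmorph B)).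

Definition tmap (B B' : pzRingType) (g : B -> B') : tseries B -> tseries B' :=
  skew_map (shift_rmorph B') (fun f : nat -> B => g \o f).

Fact fct_comp_is_zmod_morphism (B B' : pzRingType) (g : {rmorphism B -> B'}) :
  zmod_morphism (fun f : nat -> B => g \o f : nat -> B').
Proof. by move=> f f'; apply/funext => n /=; rewrite rmorphB. Qed.
Fact fct_comp_is_monoid_morphism (B B' : pzRingType) (g : {rmorphism B -> B'}) :
  monoid_morphism (fun f : nat -> B => g \o f : nat -> B').
Proof.
by split=> [|f f']; apply/funext => n /=; rewrite ?rmorph1 ?rmorphM.
Qed.

Section TMapMorphism.
Variables (B B' : pzRingType) (g : {rmorphism B -> B'}).
Let comp (f : nat -> B) : nat -> B' := g \o f.
HB.instance Definition _ := GRing.isZmodMorphism.Build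
  (nat -> B) (nat -> B') comp (fct_comp_is_zmod_morphism g).
HB.instance Definition _ := GRing.isMonoidMorphism.Build
  (nat -> B) (nat -> B') comp (fct_comp_is_monoid_morphism g).
HB.instance Definition _ := GRing.isZmodMorphism.Build
  (tseries B) (tseries B') (tmap g) 
    (@skew_map_is_zmod_morphism _ _ (shift_rmorph B) (shift_rmorph B') comp).
HB.instance Definition _ := GRing.isMonoidMorphism.Build
  (tseries B) (tseries B') (tmap g)
  (@skew_map_is_monoid_morphism _ _ (shift_rmorph B) (shift_rmorph B') comp
     (fun=> erefl)).
End TMapMorphism.

Definition tfun (B : pzRingType) (f : nat -> B) : tseries B :=
  skew_const (shift_rmorph B) f.
Definition tconst (B : pzRingType) (b : B) : tseries B := tfun (fun=> b).
Definition tX (B : pzRingType) : tseries B := skew_X (shift_rmorph B).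
Arguments tX {B}.

Section QNumbers.
Variables (C : fieldType) (q : C).

Definition qnat (n : nat) : C := \sum_(i < n) q ^+ i.
Definition qfact (n : nat) : C := \prod_(i < n) qnat i.+1.
Definition qbinom (m n : nat) : C := qfact m / (qfact (m - n)%N * qfact n).

(* For an exponent [beta] in [alpha + Z], only the value [qb] of [q^beta] is
   recorded, since all the formulas depend on [beta] through it. *)
Definition qnumber (qb : C) : C := (qb - 1) / (q - 1).
Definition qbinom_gen (qa : C) (n : nat) : C :=
  (\prod_(i < n) qnumber (qa / q ^+ i)) / qfact n.

(* [h] sends a scalar to its image in the centre of [B]. *)
Variables (B : pzRingType) (h : C -> B).

Definition hatSigma (x : tseries B) : tseries B :=
  SkewSeries _ (fun i n => h (q ^+ i) * coefs x i n.+1).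
Definition hatTheta (l : nat) (x : tseries B) : tseries B :=
  SkewSeries _ (fun i n => h (qbinom (i + l)%N l) * coefs x (i + l)%N n).

Definition tQ (qb : C) : tseries B := tfun (fun n => h (qb ^+ n)).

(* [\sum_n X^n binom(alpha, n)_q u^n Q^(alpha - n) b]: the common shape of
   [Y_0] ([u = t^-1], [b = 1]) and of its image under a deformation. *)
Definition tbinomial (qa : C) (u b : B) : tseries B :=
  SkewSeries _ (fun n m =>
    h (qbinom_gen qa n) * u ^+ n * h ((qa / q ^+ n) ^+ m) * b).

End QNumbers.

Notation "x %:F" := (@FracField.tofrac _ x) : ring_scope.

Section Fractions.
Variables (D : idomainType).

Definition frac_map (g : D -> D) (x : {fraction D}) : {fraction D} :=
  (g (\n_(repr x)))%:F / (g (\d_(repr x)))%:F.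

Definition frac_deriv (d : D -> D) (x : {fraction D}) : {fraction D} :=
  let n := \n_(repr x) in let m := \d_(repr x) in
  (d n * m - n * d m)%:F / (m ^+ 2)%:F.

Lemma repr_fracE (x : {fraction D}) : x = (\n_(repr x))%:F / (\d_(repr x))%:F.
Proof.
have dF : (\d_(repr x))%:F != 0 :> {fraction D}.
  by rewrite tofrac_eq0 denom_ratioP.
apply: (canRL (mulfK dF)); rewrite -{1}(reprK x) -{1}(Ratio_numden (repr x)).
unlock FracField.tofrac.
rewrite -[LHS]FracField.pi_mul; apply/eqmodP; rewrite /= FracField.equivfE.
rewrite /FracField.mulf !numden_Ratio ?mulf_neq0 ?oner_eq0 ?denom_ratioP //.
by rewrite !mulr1 mulrC.
Qed.

Lemma repr_crossE (n m : D) (x := repr (n%:F / m%:F : {fraction D})) :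
  m != 0 -> \d_x != 0 /\ n * \d_x = \n_x * m.
Proof.
move=> m0; split; first exact: denom_ratioP.
have /eqP := repr_fracE (n%:F / m%:F).
by rewrite eqr_div ?tofrac_eq0 ?denom_ratioP // -!tofracM tofrac_eq => /eqP.
Qed.

(* Neither operation depends on the chosen representative. *)
Lemma frac_mapE (g : {rmorphism D -> D}) (n m : D) : injective g -> m != 0 ->
  frac_map g (n%:F / m%:F) = (g n)%:F / (g m)%:F.
Proof.
move=> gI m0; have [] := repr_crossE n m0.
rewrite /frac_map; set N := \n_ _; set M := \d_ _ => M0 NM.
have g0 a : a != 0 -> (g a)%:F != 0 :> {fraction D}.
  by move=> a0; rewrite tofrac_eq0 -(rmorph0 g) (inj_eq gI).
apply/eqP; rewrite eqr_div ?g0 //.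
by rewrite -!tofracM -!rmorphM NM.
Qed.

Lemma frac_derivE (d : {additive D -> D}) (n m : D) :
  (forall a b, d (a * b) = d a * b + a * d b) -> m != 0 ->
  frac_deriv d (n%:F / m%:F) = (d n * m - n * d m)%:F / (m ^+ 2)%:F.
Proof.
move=> dM m0; have [] := repr_crossE n m0.
rewrite /frac_deriv; set N := \n_ _; set M := \d_ _ => M0 NM.
apply/eqP; rewrite eqr_div ?tofrac_eq0 ?expf_neq0 // -!tofracM tofrac_eq.
have dNM : d N * m = d n * M + n * d M - N * d m.
  by rewrite -dM NM dM addrK.
have -> : (d N * M - N * d M) * m ^+ 2 =
  M * m * (d N * m) - d M * m * (n * M) by rewrite NM; ring.
have -> : (d n * m - n * d m) * M ^+ 2 =
  d n * m * M ^+ 2 - d m * M * (N * m) by rewrite -NM; ring.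
by rewrite dNM; apply/eqP; ring.
Qed.

End Fractions.

Section FunctionField.
Variables (C : fieldType).

(* [t] is the variable of the inner polynomial ring, [y] of the outer one. *)
Definition funfield : fieldType := {fraction {poly {poly C}}}.

Definition cstL (c : C) : funfield := c%:P%:P%:F.
Definition tL : funfield := 'X%:P%:F.
Definition yL : funfield := 'X%:F.

Definition dt : funfield -> funfield := frac_deriv (map_poly (@deriv C)).
Definition dy : funfield -> funfield := frac_deriv (@deriv {poly C}).

(** [qa] is the value of [q^alpha]. *)
Variables (q qa : C).

Definition sigma : funfield -> funfield :=
  frac_map (fun p : {poly {poly C}} =>
    map_poly (comp_poly (q *: 'X)) p \Po (qa%:P *: 'X)).

Definition theta1 (a : funfield) : funfield :=
  (sigma a - a) / (cstL (q - 1) * tL).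
Definition theta (n : nat) (a : funfield) : funfield :=
  (cstL (qfact q n))^-1 * iter n theta1 a.

Definition iota (a : funfield) : tseries funfield :=
  SkewSeries _ (fun i n => iter n sigma (theta i a)).

Definition stable_subring (S : set (tseries funfield)) : Prop :=
  [/\ [/\ S 1, forall x y, S x -> S y -> S (x - y)
        & forall x y, S x -> S y -> S (x * y)],
      forall x, S x -> S (hatSigma q cstL x),
      forall l x, S x -> S (hatTheta q cstL l x),
      forall x, S x -> S (tmap dt x)
    & forall x, S x -> S (tmap dy x)].

Definition hull_set : set (tseries funfield) :=
  smallest stable_subring (range iota `|` range (@tconst funfield)).

Lemma hull_subring : [/\ hull_set 1,
    forall x y, hull_set x -> hull_set y -> hull_set (x - y)
  & forall x y, hull_set x -> hull_set y -> hull_set (x * y)].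
Proof.
split.
- by move=> S [[[S1 _ _] _ _ _ _] _].
- move=> x y xH yH S SP; have [[[_ SB _] _ _ _ _] _] := SP.
  by apply: SB; [apply: xH|apply: yH].
- move=> x y xH yH S SP; have [[[_ _ SM] _ _ _ _] _] := SP.
  by apply: SM; [apply: xH|apply: yH].
Qed.
Lemma hull_stable_Sigma x : hull_set x -> hull_set (hatSigma q cstL x).
Proof.
by move=> xH S SP; have [[_ SS _ _ _] _] := SP; apply: SS; apply: xH.
Qed.
Lemma hull_stable_Theta l x : hull_set x -> hull_set (hatTheta q cstL l x).
Proof.
by move=> xH S SP; have [[_ _ ST _ _] _] := SP; apply: ST; apply: xH.
Qed.
Lemma hull_stable_dt x : hull_set x -> hull_set (tmap dt x).
Proof.
by move=> xH S SP; have [[_ _ _ Sd _] _] := SP; apply: Sd; apply: xH.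
Qed.
Lemma hull_stable_dy x : hull_set x -> hull_set (tmap dy x).
Proof.
by move=> xH S SP; have [[_ _ _ _ Sd] _] := SP; apply: Sd; apply: xH.
Qed.

Definition in_hull : {pred tseries funfield} := fun x => x \in hull_set.

Fact in_hull_subring : subring_closed in_hull.
Proof.
have [H1 HB HM] := hull_subring.
split; first exact: (mem_set H1).
- by move=> x y /set_mem xH /set_mem yH; apply: (mem_set (HB _ _ xH yH)).
- by move=> x y /set_mem xH /set_mem yH; apply: (mem_set (HM _ _ xH yH)).
Qed.

Record hull := Hull { hull_val : tseries funfield; _ : in_hull hull_val }.

HB.instance Definition _ := [isSub for hull_val].
HB.instance Definition _ := [Choice of hull by <:].
HB.instance Definition _ :=
  GRing.SubChoice_isSubPzRing.Build _ in_hull hull in_hull_subring.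

Lemma hull_valP (x : hull) : hull_set (val x).
Proof. exact/set_mem/(valP x). Qed.

Definition hull_of (x : tseries funfield) (xH : hull_set x) : hull :=
  Hull (mem_set xH : in_hull x).

Definition hull_Sigma (x : hull) : hull :=
  hull_of (hull_stable_Sigma (hull_valP x)).
Definition hull_Theta (l : nat) (x : hull) : hull :=
  hull_of (hull_stable_Theta l (hull_valP x)).
Definition hull_dt (x : hull) : hull := hull_of (hull_stable_dt (hull_valP x)).
Definition hull_dy (x : hull) : hull := hull_of (hull_stable_dy (hull_valP x)).

Definition Y0 : tseries funfield := tbinomial q cstL qa tL^-1 1.

End FunctionField.

(* [algType] would exclude the zero algebra. *)
Record ncalg (K : pzRingType) := NCAlg {
  ncalg_sort :> pzRingType;
  ncalg_str : {rmorphism K -> ncalg_sort};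
  ncalg_central : forall a x, ncalg_str a * x = x * ncalg_str a }.
Arguments ncalg_str {K} A : rename.

Record ncalg_hom (K : pzRingType) (A B : ncalg K) := NCAlgHom {
  hom_val :> {rmorphism A -> B};
  hom_strE : forall a, hom_val (ncalg_str A a) = ncalg_str B a }.

Definition nilpotent (B : pzRingType) (x : B) : Prop := exists n, x ^+ n = 0.
Definition mutual_inverse (B : pzRingType) (x y : B) : Prop :=
  x * y = 1 /\ y * x = 1.

(* [A[[W1, W2]]]: the coefficient of [W1^i W2^j] is [coefs (coefs x j) i]. *)
Notation pseries2 A := (pseries (pseries A)).

Section Deformations.
Variables (C : fieldType) (q qa : C).
Local Notation L := (funfield C).
Local Notation hull := (hull q qa).

Section Algebra.
Variable A : ncalg L.

Definition const2 (a : A) : pseries2 A := pconst (pconst a).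
Definition cst2 (c : C) : pseries2 A := const2 (ncalg_str A (cstL c)).

Definition dW1 : pseries2 A -> pseries2 A := pmap (@deriv_series A).
Definition dW2 : pseries2 A -> pseries2 A := @deriv_series (pseries A).

Definition taylor (a : L) : pseries2 A :=
  SkewSeries _ (fun j => SkewSeries _ (fun i =>
    ncalg_str A ((i`! * j`!)%:R^-1 * iter i (@dt C) (iter j (@dy C) a)))).

Definition iotaA (x : hull) : tseries (pseries2 A) := tmap taylor (val x).

Definition is_deformation (phi : hull -> tseries (pseries2 A)) : Prop :=
  [/\ (forall x, phi (hull_Sigma x) = hatSigma q cst2 (phi x)) /\
      (forall l x, phi (hull_Theta l x) = hatTheta q cst2 l (phi x)),
      forall x, phi (hull_dt x) = tmap dW1 (phi x),
      forall x, phi (hull_dy x) = tmap dW2 (phi x),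
      forall (a : L) x, val x = tconst a -> phi x = iotaA x
    & forall x i n j1 j2,
        nilpotent (coefs (coefs (coefs (phi x - iotaA x) i n) j2) j1)].

Record NCF := MkNCF {
  ncf_val :> {rmorphism hull -> tseries (pseries2 A)};
  ncfP : is_deformation ncf_val }.

Definition affine_mx (e f : A) : 'M[A]_2 :=
  block_mx e%:M f%:M 0 1%:M : 'M_(1 + 1).

Definition affine_act (e f : A) : pseries A :=
  pconst e * (pconst (ncalg_str A (tL C)) + skew_X (id_rmorph A)) + pconst f.

Definition is_QG (g : 'M[A]_2 * pseries A) : Prop :=
  exists e f : A, let b := g.2 in
  [/\ g.1 = affine_mx e f,
      e * f = ncalg_str A (cstL q^-1) * f * e /\
        exists e' : A, mutual_inverse e e',
      affine_act e f * b - b * affine_act e f = 0,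
      nilpotent (e - 1) /\ nilpotent f
    & forall i, nilpotent (coefs (b - 1) i)].

Record QG := MkQG { qg_val :> 'M[A]_2 * pseries A; qgP : is_QG qg_val }.

Definition sends (phi : NCF) (x : tseries L) (z : tseries (pseries2 A)) :
    Prop :=
  exists2 u : hull, val u = x & phi u = z.

Definition determined_by (phi : NCF) (e f : A) (b0 : pseries A) : Prop :=
  [/\ sends phi (tQ (@cstL C) q) (tconst (const2 e) * tQ cst2 q),
      sends phi tX (tX + tconst (const2 f) * tQ cst2 q)
    & exists2 v : pseries A, mutual_inverse (affine_act e f) v &
        sends phi (Y0 q qa) (tbinomial q cst2 qa (pconst v) (pconst b0))].

End Algebra.

Section Functoriality.
Variables (A B : ncalg L) (g : ncalg_hom A B).

Definition tmap2 : tseries (pseries2 A) -> tseries (pseries2 B) :=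
  tmap (pmap (pmap g)).
HB.instance Definition _ := GRing.RMorphism.on tmap2.

Lemma tmap2_taylor x : tmap2 (iotaA A x) = iotaA B x.
Proof.
apply: skew_seriesP => i; apply/funext => n.
apply: skew_seriesP => j2; apply: skew_seriesP => j1.
exact: hom_strE.
Qed.

Lemma pmap_pconst (B1 B2 : pzRingType) (h : {rmorphism B1 -> B2}) b :
  pmap h (pconst b) = pconst (h b).
Proof. by apply: skew_seriesP => i /=; case: eqP; rewrite ?rmorph0. Qed.

Lemma pmap2_cst2 c : pmap (pmap g) (cst2 A c) = cst2 B c.
Proof. by rewrite /cst2 /const2 pmap_pconst /= pmap_pconst hom_strE. Qed.

Lemma nilpotent_hom (x : A) : nilpotent x -> nilpotent (g x).
Proof. by case=> n xn; exists n; rewrite -rmorphXn xn rmorph0. Qed.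

Lemma NCF_map_subproof (phi : NCF A) :
  is_deformation (tmap2 \o phi : hull -> tseries (pseries2 B)).
Proof.
have [[pS pT] p1 p2 pK pN] := ncfP phi; split; first split.
- move=> x /=; rewrite pS; apply: skew_seriesP => i; apply/funext => n /=.
  by rewrite rmorphM /= pmap2_cst2.
- move=> l x /=; rewrite pT; apply: skew_seriesP => i; apply/funext => n /=.
  by rewrite rmorphM /= pmap2_cst2.
- move=> x /=; rewrite p1; apply: skew_seriesP => i; apply/funext => n.
  by apply: skew_seriesP => j2; apply: skew_seriesP => j1 /=; rewrite rmorphMn.
- move=> x /=; rewrite p2; apply: skew_seriesP => i; apply/funext => n.
  by apply: skew_seriesP => j2 /=; rewrite rmorphMn.
- by move=> a x xa /=; rewrite (pK a) // tmap2_taylor.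
- move=> x i n j1 j2.
  rewrite (_ : _ - _ = tmap2 (phi x - iotaA A x)); last first.
    by rewrite rmorphB /= tmap2_taylor.
  exact: nilpotent_hom (pN x i n j1 j2).
Qed.

Definition NCF_map (phi : NCF A) : NCF B :=
  @MkNCF B (tmap2 \o phi : {rmorphism hull -> tseries (pseries2 B)})
    (NCF_map_subproof phi).

Lemma map_affine_mx (e f : A) :
  map_mx g (affine_mx e f) = affine_mx (g e) (g f).
Proof.
have := map_block_mx g (e%:M : 'M_1) (f%:M : 'M_1) (0 : 'M_1) (1%:M : 'M_1).
by rewrite !map_scalar_mx map_mx0 rmorph1.
Qed.

Lemma pmap_affine_act (e f : A) :
  pmap g (affine_act e f) = affine_act (g e) (g f).
Proof.
rewrite /affine_act rmorphD rmorphM rmorphD /= !pmap_pconst hom_strE.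
congr (_ * (_ + _) + _).
by apply: skew_seriesP => i /=; rewrite rmorph_nat.
Qed.

Lemma QG_map_subproof (x : QG A) :
  is_QG (map_mx g (qg_val x).1, pmap g (qg_val x).2 : pseries B).
Proof.
have [e [f [xE [ef [e' [ee' e'e]]] bc [en fn] bn]]] := qgP x.
exists (g e), (g f); split=> /=.
- by rewrite xE map_affine_mx.
- split; first by rewrite -rmorphM ef !rmorphM /= hom_strE.
  by exists (g e'); split; rewrite -rmorphM ?ee' ?e'e rmorph1.
- by rewrite -pmap_affine_act -!rmorphM -rmorphB bc rmorph0.
- split; last exact: nilpotent_hom.
  by have := nilpotent_hom en; rewrite rmorphB rmorph1.
- move=> i; have := nilpotent_hom (bn i).
  by rewrite /= rmorphB rmorph_nat.
Qed.

Definition QG_map (x : QG A) : QG B := MkQG (QG_map_subproof x).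

End Functoriality.
End Deformations.

Definition cexp (R : realType) (z : R[i]) : R[i] :=
  ((expR (complex.Re z) * cos (complex.Im z)) +i*
   (expR (complex.Re z) * sin (complex.Im z)))%C.

(* [qa] is one of the values of [q^alpha]. *)
Definition power_value (R : realType) (q alpha qa : R[i]) : Prop :=
  exists2 l : R[i], cexp l = q & cexp (alpha * l) = qa.

(* Main.v *)
(** A deformation [phi] is determined by its values on [Q], [X] and [Y0],
    because [iota t = t Q + X] and [iota y = Y0 y] generate [iota L] as a field,
    and the elements on which two deformations agree form a stable subring.  The
    eigenvalue equations for [hatSigma], the effect of [hatTheta] and the
    vanishing derivatives give [phi Q = e Q] and [phi X = X + f Q]; applying
    [phi] to [iota t * hatTheta 1 Y0 = [alpha]_q Y0] gives a first-order
    recurrence that determines the coefficients of [phi Y0] from [b0].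
    Since [Q X = q X Q], the relation that [phi] actually yields is
    [e f = q f e].  It is compatible with [e f = q^-1 f e] because unipotence
    of [e] forces [f = 0]: one has [(e - 1)^k f = f (q e - 1)^k], and
    [q e - 1] is invertible. *)

Require Import Defs.
From mathcomp Require Import all_boot all_order all_algebra complex reals.
From HB Require Import structures.
From mathcomp Require Import ring boolp functions.
From mathcomp Require exp trigo.

Set Implicit Arguments.
Unset Strict Implicit.
Unset Printing Implicit Defensive.

Import GRing.Theory.
Local Open Scope ring_scope.

(** * The function field *)

(* A later [HB.instance] on [g \o f] in the definitions shadows MathComp's
   instance on composites, hence this separate constant. *)
Section Composition.
Variables (R S T : pzSemiRingType).
Variables (g : {rmorphism S -> T}) (f : {rmorphism R -> S}).

Definition comp_fun (x : R) : T := g (f x).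
Fact comp_fun_is_nmod_morphism : nmod_morphism comp_fun.
Proof. by split=> [|x y]; rewrite /comp_fun ?rmorph0 ?rmorphD. Qed.
Fact comp_fun_is_monoid_morphism : monoid_morphism comp_fun.
Proof. by split=> [|x y]; rewrite /comp_fun ?rmorph1 ?rmorphM. Qed.
HB.instance Definition _ :=
  GRing.isNmodMorphism.Build R T comp_fun comp_fun_is_nmod_morphism.
HB.instance Definition _ :=
  GRing.isMonoidMorphism.Build R T comp_fun comp_fun_is_monoid_morphism.

Definition comp_rmorph : {rmorphism R -> T} := comp_fun.
End Composition.

Section FunctionField.
Variable C : fieldType.
Local Notation L := (funfield C).
Local Notation dt := (@dt C).
Local Notation dy := (@dy C).

Fact cstL_is_zmod_morphism : zmod_morphism (@cstL C).
Proof. by move=> a b; rewrite /cstL !rmorphB. Qed.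
Fact cstL_is_monoid_morphism : monoid_morphism (@cstL C).
Proof. by split=> [|a b]; rewrite /cstL ?rmorph1 ?rmorphM. Qed.
HB.instance Definition _ :=
  GRing.isZmodMorphism.Build C L (@cstL C) cstL_is_zmod_morphism.
HB.instance Definition _ :=
  GRing.isMonoidMorphism.Build C L (@cstL C) cstL_is_monoid_morphism.

Lemma cstL_eq0 (c : C) : (cstL c == 0) = (c == 0).
Proof. by rewrite tofrac_eq0 !polyC_eq0. Qed.

Lemma cstL0 : cstL 0 = 0 :> L. Proof. exact: raddf0. Qed.
Lemma cstL1 : cstL 1 = 1 :> L. Proof. exact: rmorph1. Qed.
Lemma cstLB (c d : C) : cstL (c - d) = cstL c - cstL d.
Proof. exact: cstL_is_zmod_morphism. Qed.
Lemma cstLM (c d : C) : cstL (c * d) = cstL c * cstL d.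
Proof. exact: cstL_is_monoid_morphism.2. Qed.
Lemma cstLV (c : C) : cstL c^-1 = (cstL c)^-1.
Proof. exact: (fmorphV (@cstL C)). Qed.
Lemma cstLX (c : C) n : cstL (c ^+ n) = cstL c ^+ n.
Proof. exact: (rmorphXn (@cstL C)). Qed.

Lemma tL_neq0 : tL C != 0.
Proof. by rewrite tofrac_eq0 polyC_eq0 polyX_eq0. Qed.
Lemma yL_neq0 : yL C != 0.
Proof. by rewrite tofrac_eq0 polyX_eq0. Qed.

Lemma map_poly_derivM (a b : {poly {poly C}}) :
  map_poly (@deriv C) (a * b) =
  map_poly (@deriv C) a * b + a * map_poly (@deriv C) b.
Proof.
apply/polyP => i; rewrite coef_map coefD !coefM raddf_sum -big_split /=.
by apply: eq_bigr => j _; rewrite derivM !coef_map.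
Qed.

Lemma dt_tofrac (p : {poly {poly C}}) : dt p%:F = (map_poly (@deriv C) p)%:F.
Proof.
rewrite -[p%:F]divr1 -(rmorph1 (@FracField.tofrac {poly {poly C}})) /dt.
rewrite (frac_derivE _ map_poly_derivM) ?oner_eq0 //= -[1]/(1%:P).
by rewrite map_polyC /= derivC polyC0 mulr0 subr0 mulr1 expr1n rmorph1 !divr1.
Qed.

Lemma dy_tofrac (p : {poly {poly C}}) : dy p%:F = (deriv p)%:F.
Proof.
rewrite -[p%:F]divr1 -(rmorph1 (@FracField.tofrac {poly {poly C}})) /dy.
rewrite (frac_derivE _ (@derivM _)) ?oner_eq0 //= -[1]/(1%:P).
by rewrite derivC mulr0 subr0 mulr1 expr1n rmorph1 !divr1.
Qed.

Lemma dt0 : dt (0 : L) = 0.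
Proof.
by rewrite -(rmorph0 (@FracField.tofrac {poly {poly C}})) dt_tofrac raddf0.
Qed.
Lemma dy0 : dy (0 : L) = 0.
Proof.
by rewrite -(rmorph0 (@FracField.tofrac {poly {poly C}})) dy_tofrac raddf0.
Qed.

Lemma dt_cst c : dt (cstL c) = 0.
Proof. by rewrite dt_tofrac map_polyC /= derivC polyC0 rmorph0. Qed.

Lemma dt_cstM_tL c : dt (cstL c * tL C) = cstL c.
Proof.
rewrite -tofracM -polyCM dt_tofrac map_polyC /= mul_polyC derivZ derivX.
by rewrite alg_polyC.
Qed.

Lemma dt_tL : dt (tL C) = 1.
Proof. by have := dt_cstM_tL 1; rewrite rmorph1 mul1r. Qed.

(** Numerator and denominator are constants for the outer variable. This covers the coefficients of
    [Y0], which involve only powers of t. *)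
Lemma dy_inner (n m : {poly C}) : m != 0 ->
  dy (n%:P%:F / m%:P%:F : L) = 0.
Proof.
move=> m0; rewrite /dy (frac_derivE _ (@derivM _)) ?polyC_eq0 //=.
by rewrite !derivC mul0r mulr0 subr0 rmorph0 mul0r.
Qed.

Lemma dy_tL : dy (tL C) = 0.
Proof. by rewrite dy_tofrac derivC rmorph0. Qed.
Lemma dy_cst c : dy (cstL c) = 0.
Proof. by rewrite dy_tofrac derivC rmorph0. Qed.

(** * The automorphism [sigma] of the function field *)

Section Sigma.
Variables q qa : C.
Hypothesis q_neq0 : q != 0.
Hypothesis qa_neq0 : qa != 0.

Local Notation sigma := (@sigma C q qa).

Definition sigma_poly : {rmorphism {poly {poly C}} -> {poly {poly C}}} :=
  comp_rmorph (comp_poly (qa%:P *: 'X)) (map_poly (comp_poly (q *: 'X))).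

(** Substituting a polynomial of degree one cannot kill a nonzero polynomial, and both substitutions
    have degree one because [q] and [qa] are nonzero. *)
Lemma sigma_poly_inj : injective sigma_poly.
Proof.
apply: raddf_inj => p /= /eqP.
have sz (D : idomainType) (c : D) : c != 0 -> size (c *: 'X) = 2%N.
  by move=> c0; rewrite size_scale // size_polyX.
rewrite comp_poly2_eq0 ?sz ?polyC_eq0 // => /eqP pe.
apply/polyP => i; have := congr1 (fun r : {poly {poly C}} => r`_i) pe.
by rewrite coef_map !coef0 => /eqP; rewrite /= comp_poly2_eq0 ?sz // => /eqP.
Qed.

Lemma sigma_frac n m : m != 0 ->
  sigma (n%:F / m%:F) = (sigma_poly n)%:F / (sigma_poly m)%:F.
Proof. by move=> m0; rewrite -(frac_mapE _ sigma_poly_inj). Qed.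

Lemma sigma_tofrac p : sigma p%:F = (sigma_poly p)%:F.
Proof.
rewrite -[p%:F]divr1 -(rmorph1 (@FracField.tofrac {poly {poly C}})).
by rewrite sigma_frac ?oner_eq0 // !rmorph1 divr1.
Qed.

Lemma fracP (x : L) : exists n m : {poly {poly C}},
  [/\ m != 0, m%:F != 0 :> L, (sigma_poly m)%:F != 0 :> L & x = n%:F / m%:F].
Proof.
have m0 := denom_ratioP (repr x).
exists \n_(repr x), \d_(repr x); split; rewrite ?tofrac_eq0 //.
  by rewrite raddf_eq0 //; apply: sigma_poly_inj.
exact: repr_fracE.
Qed.

Fact sigma_is_zmod_morphism : zmod_morphism sigma.
Proof.
move=> x y; have [a [b [b0 bF sb ->]]] := fracP x.
have [c [d [d0 dF sd ->]]] := fracP y.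
rewrite -mulNr addf_div // -!rmorphN -!rmorphM -rmorphD /= !sigma_frac
  ?mulf_neq0 //.
by rewrite -[in RHS]mulNr addf_div // -!rmorphN -!rmorphM -rmorphD /=
  !(rmorphD, rmorphM, rmorphN).
Qed.
Fact sigma_is_monoid_morphism : monoid_morphism sigma.
Proof.
split=> [|x y].
  by rewrite -(rmorph1 (@FracField.tofrac {poly {poly C}})) sigma_tofrac
    !rmorph1.
have [a [b [b0 bF sb ->]]] := fracP x.
have [c [d [d0 dF sd ->]]] := fracP y.
rewrite mulf_div -!rmorphM /= !sigma_frac ?mulf_neq0 //.
by rewrite mulf_div -!rmorphM /= !rmorphM.
Qed.
HB.instance Definition _ :=
  GRing.isZmodMorphism.Build L L sigma sigma_is_zmod_morphism.
HB.instance Definition _ :=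
  GRing.isMonoidMorphism.Build L L sigma sigma_is_monoid_morphism.

Definition sigma_rmorph : {rmorphism L -> L} :=
  GRing.RMorphism.clone L L sigma _.

Lemma sigma_cst c : sigma (cstL c) = cstL c.
Proof. by rewrite sigma_tofrac /= map_polyC /= !comp_polyC. Qed.
Lemma sigma_tL : sigma (tL C) = cstL q * tL C.
Proof.
rewrite sigma_tofrac /= map_polyC /= comp_polyX comp_polyC -mul_polyC polyCM.
by rewrite rmorphM.
Qed.
Lemma sigma_yL : sigma (yL C) = cstL qa * yL C.
Proof. by rewrite sigma_tofrac /= map_polyX comp_polyX -mul_polyC rmorphM. Qed.

End Sigma.
End FunctionField.

(** * Twisted power series *)

Section QNat.
Variables (C : fieldType) (q : C).
Hypothesis q_not_root : forall n, (0 < n)%N -> q ^+ n != 1.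

Lemma qnatD m n : qnat q (m + n) = qnat q m + q ^+ m * qnat q n.
Proof.
rewrite /qnat big_split_ord mulr_sumr; congr (_ + _).
by apply: eq_bigr => i _; rewrite exprD.
Qed.

Lemma q_sub1_neq0 : q - 1 != 0.
Proof. by rewrite subr_eq0 -[q]expr1 q_not_root. Qed.

Lemma qnatE n : qnat q n = (q ^+ n - 1) / (q - 1).
Proof. by rewrite subrX1 mulrC mulKf // q_sub1_neq0. Qed.

Lemma qnat_neq0 n : qnat q n.+1 != 0.
Proof.
by rewrite qnatE mulf_neq0 ?invr_eq0 ?q_sub1_neq0 // subr_eq0 q_not_root.
Qed.

Lemma qfactS n : qfact q n.+1 = qfact q n * qnat q n.+1.
Proof. by rewrite /qfact big_ord_recr. Qed.

Lemma qfact_neq0 n : qfact q n != 0.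
Proof. by apply/prodf_neq0 => i _; apply: qnat_neq0. Qed.

Lemma qbinom1 i : qbinom q (i + 1) 1 = qnat q i.+1.
Proof.
rewrite /qbinom addnK addn1 qfactS /qfact big_ord1 /qnat big_ord1 expr0 mulr1.
by rewrite mulrAC mulfV ?mul1r ?qfact_neq0.
Qed.

Lemma qbinomnn l : qbinom q l l = 1.
Proof.
rewrite /qbinom subnn {2}/qfact big_ord0 mul1r mulfV ?qfact_neq0 //.
Qed.

Lemma qbinom_gen0 qa : qbinom_gen q qa 0 = 1.
Proof. by rewrite /qbinom_gen /qfact !big_ord0 divr1. Qed.

Lemma qbinom_genS qa i :
  qbinom_gen q qa i.+1 * qnat q i.+1 = qnumber q (qa / q ^+ i) * qbinom_gen q
    qa i.
Proof.
rewrite /qbinom_gen big_ord_recr /= qfactS invfM.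
have := qnat_neq0 i; have := qfact_neq0 i => h1 h2.
by field; rewrite h1 h2.
Qed.

(** Read [qa / q ^+ i] as q^(alpha-i): this is the q-analogue of alpha = i + (alpha - i). In the
    recurrences below the summand [i]_q matches the contribution of X. *)
Lemma qnumber_shift qa i : q != 0 ->
  qnumber q qa = qnat q i + q ^+ i * qnumber q (qa / q ^+ i).
Proof.
move=> q0; rewrite /qnumber qnatE mulrA -mulrDl; congr (_ / _).
by rewrite mulrBr mulr1 mulrCA mulfV ?expf_neq0 // mulr1 [RHS]addrC subrKA.
Qed.

(** The recurrence for the coefficients of [Y0] at the index n; the factor q^(n+i) is the value at n
    of Q after it has passed X^i. *)
Lemma qbinom_gen_rec qa i n : q != 0 ->
  q ^+ (n + i) * qnat q i.+1 * (qbinom_gen q qa i.+1 * (qa / q ^+ i.+1) ^+ n) =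
  q ^+ i * qnumber q (qa / q ^+ i) * (qbinom_gen q qa i * (qa / q ^+ i) ^+ n).
Proof.
move=> q0; transitivity (q ^+ i * (qbinom_gen q qa i.+1 * qnat q i.+1) *
    (q * (qa / q ^+ i.+1)) ^+ n).
  by rewrite exprD [(q * _) ^+ n]exprMn; move: (_ ^+ n) (_ ^+ n) => u v; ring.
rewrite qbinom_genS exprS invfM (mulrCA qa) mulVKf //.
by ring.
Qed.

End QNat.

(** * Products of twisted series and the twisted Leibniz rule *)

Section TwistedSeries.
Variable B : pzRingType.
Implicit Types x y : tseries B.

Lemma iter_shift j (f : nat -> B) n : iter j (@shift B) f n = f (n + j)%N.
Proof. by elim: j n => [|j IH] n /=; rewrite ?addn0 // /shift IH addSnnS. Qed.

(** Moving a coefficient to the right of X^j applies the shift j times, whence the argument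
    [n + j]. *)
Lemma coefs_tmul x y i n : coefs (x * y) i n =
  \sum_(j < i.+1) coefs x (i - j)%N (n + j)%N * coefs y j n.
Proof.
rewrite /= fct_sumE; apply: eq_bigr => j _.
by rewrite /= -iter_shift.
Qed.

Lemma tseriesP x y : (forall i n, coefs x i n = coefs y i n) -> x = y.
Proof. by move=> e; apply: skew_seriesP => i; apply/funext => n. Qed.

Lemma coefsD x y i n : coefs (x + y) i n = coefs x i n + coefs y i n.
Proof. by []. Qed.

Lemma coefs_Mtconst (b : B) x i n : coefs (x * tconst b) i n = coefs x i n * b.
Proof.
rewrite coefs_tmul big_ord_recl /= subn0 addn0 big1 ?addr0 //= => j _.
by rewrite mulr0.
Qed.

Lemma coefs_tfunM (g : nat -> B) x i n :
  coefs (tfun g * x) i n = g (n + i)%N * coefs x i n.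
Proof.
rewrite coefs_tmul big_ord_recr /= subnn big1 ?add0r //= => j _.
by rewrite subn_eq0 leqNgt ltn_ord /= mul0r.
Qed.

Lemma coefs_tconstM (b : B) x i n : coefs (tconst b * x) i n = b * coefs x i n.
Proof. exact: coefs_tfunM. Qed.

Lemma coefs_tXM x i n :
  coefs (tX * x) i n = if i is i'.+1 then coefs x i' n else 0.
Proof.
rewrite coefs_tmul; case: i => [|i]; first by rewrite big_ord1 mul0r.
rewrite !big_ord_recr /= subSnn subnn mul1r mul0r addr0 big1 ?add0r // => j _.
by rewrite subSn 1?ltnW //= eqSS subn_eq0 leqNgt ltn_ord mul0r.
Qed.

Lemma coefs_MtX x i n :
  coefs (x * tX) i n = if i is i'.+1 then coefs x i' n.+1 else 0.
Proof.
rewrite coefs_tmul; case: i => [|i]; first by rewrite big_ord1 mulr0.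
rewrite 2!big_ord_recl /= mulr0 add0r subSS subn0 mulr1 addn1 big1 ?addr0 //
  => j _.
by rewrite mulr0.
Qed.

Lemma coef0_tmul x y n : coefs (x * y) 0 n = coefs x 0 n * coefs y 0 n.
Proof. by rewrite coefs_tmul big_ord1 addn0. Qed.

Fact tconst_is_zmod_morphism : zmod_morphism (@tconst B).
Proof. by move=> a b; apply: tseriesP => -[|i] n /=; rewrite ?subr0. Qed.
Fact tconst_is_monoid_morphism : monoid_morphism (@tconst B).
Proof.
split=> [|a b]; first by apply: tseriesP => -[|i] n.
by apply: tseriesP => -[|i] n; rewrite coefs_tconstM //= mulr0.
Qed.
HB.instance Definition _ :=
  GRing.isZmodMorphism.Build B (tseries B) (@tconst B) tconst_is_zmod_morphism.
HB.instance Definition _ :=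
  GRing.isMonoidMorphism.Build B (tseries B) (@tconst B)
    tconst_is_monoid_morphism.

Lemma tconstM_tfun (b : B) (g : nat -> B) :
  tconst b * tfun g = tfun (fun n => b * g n).
Proof.
by apply: tseriesP => -[|i] n; rewrite coefs_tconstM //= mulr0.
Qed.

Section Derivation.
Variables (C : fieldType) (q : C) (h : {rmorphism C -> B}).
Hypothesis q_not_root : forall n, (0 < n)%N -> q ^+ n != 1.
Hypothesis hC : forall c b, h c * b = b * h c.

(** Term by term in the convolution this is [i+1] = [i+1-k] + q^(i+1-k) [k]. *)
Lemma hatTheta1M x y : hatTheta q h 1 (x * y) =
  hatTheta q h 1 x * y + hatSigma q h x * hatTheta q h 1 y.
Proof.
apply: tseriesP => i n; rewrite coefsD.
pose a k := coefs x (i.+1 - k)%N (n + k)%N * coefs y k n.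
have -> : coefs (hatTheta q h 1 (x * y)) i n =
    \sum_(k < i.+2) h (qnat q i.+1) * a k.
  transitivity (h (qbinom q (i + 1) 1) * coefs (x * y) (i + 1)%N n) => //.
  by rewrite qbinom1 // coefs_tmul mulr_sumr addn1.
(* Both summands are extended to the range k <= i+1. Here the added term is k = i+1, of weight [0] =
   0. *)
have -> : coefs (hatTheta q h 1 x * y) i n =
    \sum_(k < i.+2) h (qnat q (i.+1 - k)) * a k.
  rewrite coefs_tmul [RHS]big_ord_recr /= subnn [qnat q 0]big_ord0.
  rewrite rmorph0 mul0r addr0; apply: eq_bigr => j _.
  by rewrite qbinom1 // mulrA addn1 subSn // -ltnS.
(* Here k = j + 1, and the added term k = 0 has weight [0] = 0. *)
have -> : coefs (hatSigma q h x * hatTheta q h 1 y) i n =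
    \sum_(k < i.+2) h (q ^+ (i.+1 - k) * qnat q k) * a k.
  rewrite coefs_tmul [RHS]big_ord_recl /= [qnat q 0]big_ord0.
  rewrite mulr0 rmorph0 mul0r add0r; apply: eq_bigr => j _.
  rewrite qbinom1 // rmorphM /a subSS addn1 /bump leq0n add1n addnS.
  by rewrite -!mulrA; congr (_ * _); rewrite !mulrA hC.
rewrite -big_split; apply: eq_bigr => k _ /=.
by rewrite -mulrDl -rmorphD -qnatD // subnK // -ltnS.
Qed.

Lemma coefs_hatTheta1 x i n :
  coefs (hatTheta q h 1 x) i n = h (qnat q i.+1) * coefs x i.+1 n.
Proof. by rewrite /= qbinom1 // addn1. Qed.

(** [tfun g + tX] is the shape of iota t and of its image under a deformation, so an equation with
    this factor becomes a two-term recurrence in i. *)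
Lemma coefs_linear_hatTheta1 (g : nat -> B) x i n :
  coefs ((tfun g + tX) * hatTheta q h 1 x) i n =
  g (n + i)%N * (h (qnat q i.+1) * coefs x i.+1 n) + h (qnat q i) * coefs x i n.
Proof.
rewrite mulrDl coefsD coefs_tfunM coefs_tXM coefs_hatTheta1; congr (_ + _).
by case: i => [|i]; rewrite ?coefs_hatTheta1 // [qnat q 0]big_ord0 rmorph0
  mul0r.
Qed.

End Derivation.
End TwistedSeries.

(** * The universal Taylor morphism [iota] *)

Section Hull.
Variables (C : fieldType) (q qa : C).
Hypothesis q_neq0 : q != 0.
Hypothesis qa_neq0 : qa != 0.
Hypothesis q_not_root : forall n, (0 < n)%N -> q ^+ n != 1.
Local Notation L := (funfield C).
Local Notation dt := (@dt C).
Local Notation dy := (@dy C).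
Local Notation tL := (tL C).
Local Notation yL := (yL C).
Local Notation sigma := (@sigma C q qa).
Local Notation theta1 := (@theta1 C q qa).
Local Notation theta := (@theta C q qa).
Local Notation iota := (@Defs.iota C q qa).
Local Notation cstL := (@cstL C).

Let sg := sigma_rmorph q_neq0 qa_neq0.

Lemma iter_sigmaM n a b : iter n sigma (a * b) =
  iter n sigma a * iter n sigma b.
Proof. exact: (rmorphM (iter n sg)). Qed.
Lemma iter_sigmaB n a b : iter n sigma (a - b) =
  iter n sigma a - iter n sigma b.
Proof. exact: (rmorphB (iter n sg)). Qed.
Lemma iter_sigmaV n a : iter n sigma a^-1 = (iter n sigma a)^-1.
Proof. exact: (fmorphV (iter n sg)). Qed.
Lemma iter_sigmaX n a k : iter n sigma (a ^+ k) = iter n sigma a ^+ k.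
Proof. exact: (rmorphXn (iter n sg)). Qed.
Lemma iter_sigma0 n : iter n sigma 0 = 0.
Proof. by rewrite -{1}(subrr 0) iter_sigmaB subrr. Qed.
Lemma iter_sigma_cst n c : iter n sigma (cstL c) = cstL c.
Proof. by elim: n => //= n ->; rewrite sigma_cst. Qed.
Lemma iter_sigma1 n : iter n sigma 1 = 1.
Proof. exact: (rmorph1 (iter n sg)). Qed.
Lemma iter_sigma_tL n : iter n sigma tL = cstL (q ^+ n) * tL.
Proof.
elim: n => [|n]; first by rewrite expr0 cstL1 mul1r.
rewrite iterSr sigma_tL // iter_sigmaM iter_sigma_cst => ->.
by rewrite exprS cstLM mulrA.
Qed.
Lemma iter_sigma_yL n : iter n sigma yL = cstL (qa ^+ n) * yL.
Proof.
elim: n => [|n]; first by rewrite expr0 cstL1 mul1r.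
rewrite iterSr sigma_yL // iter_sigmaM iter_sigma_cst => ->.
by rewrite exprS cstLM mulrA.
Qed.

Lemma sigmaM a b : sigma (a * b) = sigma a * sigma b.
Proof. exact: (iter_sigmaM 1). Qed.
Lemma sigmaB a b : sigma (a - b) = sigma a - sigma b.
Proof. exact: (iter_sigmaB 1). Qed.
Lemma sigmaV a : sigma a^-1 = (sigma a)^-1.
Proof. exact: (iter_sigmaV 1). Qed.

Lemma theta1_den_neq0 : cstL (q - 1) * tL != 0.
Proof. by apply: mulf_neq0 (tL_neq0 C); rewrite cstL_eq0 q_sub1_neq0. Qed.

Lemma theta1B a b : theta1 (a - b) = theta1 a - theta1 b.
Proof. by rewrite /theta1 -mulrBl sigmaB !opprD !opprK addrACA. Qed.

Lemma theta1M a b : theta1 (a * b) = theta1 a * b + sigma a * theta1 b.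
Proof.
rewrite /theta1 sigmaM [(_ - a) / _ * b]mulrAC [sigma a * ((_ - b) / _)]mulrA
  -mulrDl.
by congr (_ / _); rewrite mulrBl mulrBr [RHS]addrC subrKA.
Qed.

Lemma theta1_cst c : theta1 (cstL c) = 0.
Proof. by rewrite /theta1 sigma_cst // subrr mul0r. Qed.

Lemma theta1_1 : theta1 1 = 0.
Proof. by have := theta1_cst 1; rewrite cstL1. Qed.

Lemma theta1_tL : theta1 tL = 1.
Proof.
have sE : sigma tL - tL = cstL (q - 1) * tL.
  by rewrite sigma_tL // cstLB cstL1 mulrBl mul1r.
by rewrite /theta1 sE; apply: divff theta1_den_neq0.
Qed.

(** The factor q arises because [sigma] multiplies the denominator (q-1)t by q. *)
Lemma theta1_sigma a : theta1 (sigma a) = cstL q * sigma (theta1 a).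
Proof.
rewrite /theta1 sigmaM sigmaV sigmaB sigmaM sigma_cst // sigma_tL //.
rewrite [RHS]mulrCA; congr (_ * _); rewrite [cstL (q - 1) * (_ * _)]mulrCA.
by rewrite [in RHS]invfM mulVKf ?cstL_eq0.
Qed.

(** With c in the role of q^beta: an eigenvector of [sigma] for q^beta is an eigenvector of t times
    [theta1] for [beta]_q. *)
Lemma theta1_eigen a c : sigma a = cstL c * a ->
  theta1 a = cstL (qnumber q c) * (tL^-1 * a).
Proof.
move=> sE; have sE' : sigma a - a = cstL (c - 1) * a.
  by rewrite sE cstLB cstL1 mulrBl mul1r.
rewrite /theta1 sE' /qnumber [in RHS]cstLM cstLV invfM -!mulrA; congr (_ * _).
by rewrite mulrCA [a * _]mulrC.
Qed.

(* Unification otherwise unfolds these on every failed match. *)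
#[local] Opaque Defs.sigma Defs.theta1.

Lemma iter_theta1B n a b :
  iter n theta1 (a - b) = iter n theta1 a - iter n theta1 b.
Proof. by elim: n => //= n ->; rewrite theta1B. Qed.

Lemma theta1_cstM c a : theta1 (cstL c * a) = cstL c * theta1 a.
Proof. by rewrite theta1M theta1_cst mul0r add0r sigma_cst. Qed.

Lemma iter_theta1_sigma n a :
  iter n theta1 (sigma a) = cstL (q ^+ n) * sigma (iter n theta1 a).
Proof.
elim: n => [|n IH]; first by rewrite expr0 cstL1 mul1r.
rewrite iterS IH theta1_cstM theta1_sigma mulrA -cstLM -exprSr.
by rewrite iterS.
Qed.

Lemma theta_sigma i a : theta i (sigma a) = cstL (q ^+ i) * sigma (theta i a).
Proof.
by rewrite /theta iter_theta1_sigma sigmaM sigmaV sigma_cst // mulrCA.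
Qed.

Lemma iota_sigma a : hatSigma q cstL (iota a) = iota (sigma a).
Proof.
apply: tseriesP => i n.
transitivity (cstL (q ^+ i) * iter n.+1 sigma (theta i a)) => //.
transitivity (iter n sigma (theta i (sigma a))) => //.
by rewrite theta_sigma iter_sigmaM iter_sigma_cst -iterSr.
Qed.

Lemma theta_theta1 i a : cstL (qnat q i.+1) * theta i.+1 a = theta i (theta1 a).
Proof.
rewrite /theta -iterSr qfactS cstLM mulrA; congr (_ * _).
by rewrite invfM mulrCA mulfV ?mulr1 // cstL_eq0 qnat_neq0.
Qed.

Lemma iota_theta1 a : hatTheta q cstL 1 (iota a) = iota (theta1 a).
Proof.
apply: tseriesP => i n; rewrite coefs_hatTheta1 //.
transitivity (cstL (qnat q i.+1) * iter n sigma (theta i.+1 a)) => //.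
transitivity (iter n sigma (theta i (theta1 a))) => //.
by rewrite -theta_theta1 iter_sigmaM iter_sigma_cst.
Qed.

Lemma coef0_iota a n : coefs (iota a) 0 n = iter n sigma a.
Proof. by rewrite /= /theta /qfact big_ord0 cstL1 invr1 mul1r. Qed.

Lemma iota_subr a b : iota (a - b) = iota a - iota b.
Proof.
apply: tseriesP => i n.
by rewrite /= /theta iter_theta1B mulrBr iter_sigmaB.
Qed.

Lemma iota_zero : iota 0 = 0.
Proof. by rewrite -{1}(subrr 0) iota_subr subrr. Qed.

Lemma iota_addr a b : iota (a + b) = iota a + iota b.
Proof.
by rewrite -{1}[b]opprK -[- b]sub0r !iota_subr iota_zero sub0r opprK.
Qed.

(* The [sigma]-derivation [theta1] determines [iota] from its constant terms, so
   multiplicativity follows from the first-order Leibniz rules alone. *)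
Lemma iota_mulr a b : iota (a * b) = iota a * iota b.
Proof.
suff E i n a' b' : coefs (iota (a' * b')) i n = coefs (iota a' * iota b') i n.
  exact: tseriesP.
elim: i a' b' => [|i IH] {}a {}b.
  by rewrite coefs_tmul big_ord1 addn0 !coef0_iota iter_sigmaM.
have hq : cstL (qnat q i.+1) != 0 by rewrite cstL_eq0 qnat_neq0.
apply: (mulfI hq); rewrite -!coefs_hatTheta1 // hatTheta1M //; last first.
  by move=> *; rewrite mulrC.
by rewrite !iota_theta1 iota_sigma theta1M iota_addr !coefsD !IH.
Qed.

Lemma iter_theta1_0 n : iter n theta1 0 = 0.
Proof. by rewrite -{1}(subrr 0) iter_theta1B subrr. Qed.

Lemma iota_cst c : iota (cstL c) = tconst (cstL c).
Proof.
apply: tseriesP => -[|i] n; first by rewrite coef0_iota iter_sigma_cst.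
transitivity (iter n sigma (theta i.+1 (cstL c))) => //.
by rewrite /theta iterSr theta1_cst iter_theta1_0 mulr0 iter_sigma0.
Qed.

Lemma iota_one : iota 1 = 1.
Proof. by have := iota_cst 1; rewrite cstL1 rmorph1. Qed.

Lemma iota_tL : iota tL = tfun (fun n => cstL (q ^+ n) * tL) + tX.
Proof.
apply: tseriesP => i n; rewrite coefsD.
case: i => [|[|i]]; first by rewrite coef0_iota iter_sigma_tL [RHS]addr0.
- transitivity (iter n sigma (theta 1 tL)) => //.
  rewrite /theta /qfact big_ord1 /qnat big_ord1 expr0 cstL1 invr1 mul1r.
  by rewrite /= theta1_tL iter_sigma1 add0r.
- transitivity (iter n sigma (theta i.+2 tL)) => //.
  rewrite /theta 2!iterSr theta1_tL theta1_1 iter_theta1_0.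
  by rewrite mulr0 iter_sigma0 [RHS]addr0.
Qed.

(** Each t^-i y is an eigenvector of [sigma] for q^(alpha-i). *)
Lemma theta1_monomial i : theta1 (tL^-1 ^+ i * yL) =
  cstL (qnumber q (qa / q ^+ i)) * (tL^-1 ^+ i.+1 * yL).
Proof.
rewrite exprS -mulrA; apply: theta1_eigen.
rewrite (rmorphM sg) (rmorphXn sg) (fmorphV sg) [sg tL]sigma_tL //.
rewrite [sg yL]sigma_yL // invfM exprMn -cstLV -cstLX [q^-1 ^+ i]exprVn.
by rewrite mulrACA -cstLM [_ * qa]mulrC.
Qed.

Lemma theta_yL i :
  theta i yL = cstL (qbinom_gen q qa i) * (tL^-1 ^+ i * yL).
Proof.
have pE : iter i theta1 yL =
    cstL (\prod_(j < i) qnumber q (qa / q ^+ j)) * (tL^-1 ^+ i * yL).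
  elim: i => [|i IH]; first by rewrite big_ord0 cstL1 expr0 !mul1r.
  rewrite iterS IH theta1_cstM theta1_monomial mulrA -cstLM.
  by rewrite big_ord_recr.
by rewrite /theta pE mulrA -cstLV -cstLM [_^-1 * _]mulrC.
Qed.

Lemma iota_yL : iota yL = Y0 q qa * tconst yL.
Proof.
apply: tseriesP => i n; rewrite coefs_Mtconst.
transitivity (iter n sigma (theta i yL)) => //.
rewrite theta_yL iter_sigmaM iter_sigma_cst iter_sigmaM iter_sigma_yL.
rewrite iter_sigmaX iter_sigmaV iter_sigma_tL /= mulr1.
rewrite invfM exprMn -cstLV -cstLX mulrACA -cstLM !mulrA; congr (_ * yL).
(* The n-th iterate of [sigma] contributes (q^n)^-i from t^-i and (q^alpha)^n from y, together
   (q^(alpha-i))^n. *)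
rewrite -!mulrA; congr (_ * _); rewrite mulrC; congr (_ * cstL _).
by rewrite expr_div_n exprVn -!exprM mulnC mulrC.
Qed.

End Hull.

(** * Relations in the Galois hull *)

Section HullElements.
Variables (C : fieldType) (q qa : C).
Local Notation L := (funfield C).
Local Notation hull := (hull q qa).
Local Notation tL := (tL C).
Local Notation yL := (yL C).
Local Notation cstL := (@cstL C).

Lemma hull_set_iota a : hull_set q qa (Defs.iota q qa a).
Proof. by move=> S [_ sub]; apply: sub; left; exists a. Qed.
Lemma hull_set_cst (a : L) : hull_set q qa (tconst a).
Proof. by move=> S [_ sub]; apply: sub; right; exists a. Qed.

Definition hull_iota a : hull := hull_of (hull_set_iota a).
Definition hull_cst (a : L) : hull := hull_of (hull_set_cst a).
(** Since iota t = tQ + X, differentiating the values in t isolates Q. Subtracting tQ then leaves X,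
    and [Y0] is iota y divided by the constant y. *)
Definition hull_Q : hull := hull_dt (hull_iota tL).
Definition hull_X : hull := hull_iota tL - hull_cst tL * hull_Q.
Definition hull_Y0 : hull := hull_iota yL * hull_cst yL^-1.

Hypothesis q_neq0 : q != 0.
Hypothesis qa_neq0 : qa != 0.
Hypothesis q_not_root : forall n, (0 < n)%N -> q ^+ n != 1.

Lemma hull_valM (x y : hull) : val (x * y) = val x * val y.
Proof. by []. Qed.
Lemma hull_valB (x y : hull) : val (x - y) = val x - val y.
Proof. by []. Qed.

Lemma val_hull_Q : val hull_Q = tQ cstL q.
Proof.
transitivity (tmap (@dt C) (Defs.iota q qa tL)) => //.
rewrite iota_tL //; apply: tseriesP => i n.
transitivity (dt (coefs (tfun (fun n => cstL (q ^+ n) * tL) + tX) i n)) => //.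
rewrite coefsD; case: i => [|[|i]].
- by rewrite [_ + _]addr0 dt_cstM_tL.
- by rewrite [_ + _]add0r; have := dt_cst (1 : C); rewrite cstL1.
- by rewrite [_ + _]addr0 dt0.
Qed.

Lemma val_hull_iota_tL : val (hull_iota tL) =
  tfun (fun n => cstL (q ^+ n) * tL) + tX.
Proof. exact: iota_tL. Qed.

Lemma val_hull_X : val hull_X = tX.
Proof.
rewrite hull_valB hull_valM val_hull_Q val_hull_iota_tL; apply/eqP.
rewrite subr_eq addrC; apply/eqP; congr (_ + _).
apply: tseriesP => i n; rewrite coefs_tconstM.
by case: i => [|i]; [apply: mulrC|rewrite [RHS]mulr0].
Qed.

Lemma val_hull_Y0 : val hull_Y0 = Y0 q qa.
Proof.
rewrite hull_valM; transitivity (Defs.iota q qa yL * tconst yL^-1) => //.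
rewrite iota_yL // -mulrA -(rmorphM (@tconst L)) mulfV ?yL_neq0 //.
by rewrite (rmorph1 (@tconst L)) mulr1.
Qed.

Lemma hull_iota_yL : hull_iota yL = hull_Y0 * hull_cst yL.
Proof. by apply: val_inj; rewrite hull_valM val_hull_Y0; apply: iota_yL. Qed.

Lemma hull_iota_tL : hull_iota tL = hull_cst tL * hull_Q + hull_X.
Proof. by rewrite addrC subrK. Qed.

Lemma hull_cstC a x : hull_cst a * x = x * hull_cst a.
Proof.
apply: val_inj; rewrite !hull_valM; apply: tseriesP => i n.
by rewrite coefs_tconstM coefs_Mtconst mulrC.
Qed.

(** This relation and those that follow hold inside the hull, so a ring morphism commuting with the
    operators carries them over to the images of Q, X and [Y0]. *)
Lemma hull_Sigma_Q : hull_Sigma hull_Q = hull_cst (cstL q) * hull_Q.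
Proof.
apply: val_inj; rewrite hull_valM.
transitivity (hatSigma q cstL (val hull_Q)) => //; rewrite val_hull_Q.
apply: tseriesP => i n; rewrite coefs_tconstM.
case: i => [|i] /=; last by rewrite !mulr0.
by rewrite expr0 cstL1 mul1r exprS cstLM.
Qed.

Lemma hull_Theta_Q l : hull_Theta l.+1 hull_Q = 0.
Proof.
apply: val_inj.
transitivity (hatTheta q cstL l.+1 (val hull_Q)) => //; rewrite val_hull_Q.
by apply: tseriesP => i n /=; rewrite addnS /= mulr0.
Qed.

Lemma hull_dt_Q : hull_dt hull_Q = 0.
Proof.
apply: val_inj.
transitivity (tmap (@dt C) (val hull_Q)) => //; rewrite val_hull_Q.
by apply: tseriesP => -[|i] n /=; [apply: dt_cst|apply: dt0].
Qed.

Lemma hull_dy_Q : hull_dy hull_Q = 0.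
Proof.
apply: val_inj.
transitivity (tmap (@dy C) (val hull_Q)) => //; rewrite val_hull_Q.
by apply: tseriesP => -[|i] n /=; [apply: dy_cst|apply: dy0].
Qed.

Lemma hull_Sigma_X : hull_Sigma hull_X = hull_cst (cstL q) * hull_X.
Proof.
apply: val_inj; rewrite hull_valM.
transitivity (hatSigma q cstL (val hull_X)) => //; rewrite val_hull_X.
apply: tseriesP => i n; rewrite coefs_tconstM.
by case: i => [|[|i]] /=; rewrite ?mulr0 // expr1.
Qed.

Lemma hull_Theta1_X : hull_Theta 1 hull_X = 1.
Proof.
apply: val_inj.
transitivity (hatTheta q cstL 1 (val hull_X)) => //; rewrite val_hull_X.
apply: tseriesP => i n; rewrite coefs_hatTheta1 //.
case: i => [|i] /=; last by rewrite mulr0.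
by rewrite /qnat big_ord1 expr0 cstL1 mul1r.
Qed.

Lemma hull_Theta_X l : hull_Theta l.+2 hull_X = 0.
Proof.
apply: val_inj.
transitivity (hatTheta q cstL l.+2 (val hull_X)) => //; rewrite val_hull_X.
by apply: tseriesP => i n /=; rewrite 2!addnS /= mulr0.
Qed.

Lemma hull_dt_X : hull_dt hull_X = 0.
Proof.
apply: val_inj.
transitivity (tmap (@dt C) (val hull_X)) => //; rewrite val_hull_X.
apply: tseriesP => -[|[|i]] n /=; [exact: dt0| |exact: dt0].
by have := dt_cst (1 : C); rewrite cstL1.
Qed.

Lemma hull_dy_X : hull_dy hull_X = 0.
Proof.
apply: val_inj.
transitivity (tmap (@dy C) (val hull_X)) => //; rewrite val_hull_X.
apply: tseriesP => -[|[|i]] n /=; [exact: dy0| |exact: dy0].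
by have := dy_cst (1 : C); rewrite cstL1.
Qed.

(** Passing X to the left shifts Q, and the shift of Q is qQ. *)
Lemma hull_QX : hull_Q * hull_X = hull_cst (cstL q) * (hull_X * hull_Q).
Proof.
apply: val_inj; rewrite !hull_valM val_hull_Q val_hull_X.
apply: tseriesP => i n; rewrite coefs_tconstM coefs_MtX coefs_tXM.
case: i => [|[|i]] /=; rewrite ?mulr0 //.
by rewrite exprS cstLM.
Qed.

Lemma coefs_Y0 i n : coefs (Y0 q qa) i n =
  cstL (qbinom_gen q qa i * (qa / q ^+ i) ^+ n) * tL^-1 ^+ i.
Proof. by rewrite /= mulr1 cstLM mulrAC. Qed.

(** The factor q^i that [hatSigma] puts on X^i cancels the q^-i in q^(alpha-i), so all terms share
    one eigenvalue. *)
Lemma hull_Sigma_Y0 : hull_Sigma hull_Y0 = hull_cst (cstL qa) * hull_Y0.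
Proof.
apply: val_inj; rewrite hull_valM.
transitivity (hatSigma q cstL (val hull_Y0)) => //; rewrite val_hull_Y0.
apply: tseriesP => i n; rewrite coefs_tconstM coefs_Y0 mulrA -cstLM.
transitivity (cstL (q ^+ i) * coefs (Y0 q qa) i n.+1) => //.
rewrite coefs_Y0 mulrA -cstLM; congr (cstL _ * _).
rewrite mulrCA [RHS]mulrCA; congr (_ * _).
by rewrite exprS mulrA mulrCA mulfV ?expf_neq0 // mulr1.
Qed.

Lemma hull_dy_Y0 : hull_dy hull_Y0 = 0.
Proof.
apply: val_inj.
transitivity (tmap (@dy C) (val hull_Y0)) => //; rewrite val_hull_Y0.
apply: tseriesP => i n.
transitivity (dy (coefs (Y0 q qa) i n)) => //; rewrite coefs_Y0 exprVn.
set c := (_ * _ : C).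
have -> : cstL c / tL ^+ i = c%:P%:P%:F / (('X^i : {poly C})%:P)%:F.
  by rewrite [in RHS]rmorphXn [in RHS](rmorphXn (@FracField.tofrac _)).
by rewrite dy_inner // -size_poly_eq0 size_polyXn.
Qed.

(** This is the q-difference equation of y, t theta1(y) = [alpha]_q y, with the constant y removed.
    It is checked coefficient by coefficient. *)
Lemma hull_iota_tL_Y0 : hull_iota tL * hull_Theta 1 hull_Y0 =
  hull_cst (cstL (qnumber q qa)) * hull_Y0.
Proof.
apply: val_inj; rewrite (hull_valM (hull_iota _)) (hull_valM (hull_cst _)).
rewrite val_hull_iota_tL val_hull_Y0.
transitivity ((tfun (fun n => cstL (q ^+ n) * tL) + tX) *
  hatTheta q cstL 1 (val hull_Y0)) => //; rewrite val_hull_Y0.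
apply: tseriesP => i n; rewrite coefs_linear_hatTheta1 //.
(* Split [alpha] = [i] + q^i [alpha-i]: the first summand matches the X term, the second is the
   recurrence of the binomials. *)
rewrite coefs_tconstM (qnumber_shift q_not_root qa i q_neq0) (rmorphD cstL).
rewrite mulrDl [RHS]addrC; congr (_ + _); rewrite !coefs_Y0.
rewrite [RHS]mulrA -[in RHS]cstLM -qbinom_gen_rec // 2![in RHS]cstLM -!mulrA.
by rewrite !(mulrCA tL) [tL^-1 ^+ _]exprS (mulVKf (tL_neq0 C)).
Qed.

(** t and y commute in L and iota is multiplicative; the remaining factor y^-1 is a central
    constant. *)
Lemma hull_iota_tL_comm_Y0 : hull_iota tL * hull_Y0 = hull_Y0 * hull_iota tL.
Proof.
have tyC : hull_iota tL * hull_iota yL = hull_iota yL * hull_iota tL.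
  apply: val_inj; rewrite !hull_valM.
  transitivity (Defs.iota q qa tL * Defs.iota q qa yL) => //.
  by rewrite -iota_mulr // mulrC iota_mulr.
by rewrite mulrA tyC -!mulrA hull_cstC.
Qed.

End HullElements.

(** * Power series and recurrences *)

Section PowerSeries.
Variable B : pzRingType.
Implicit Types x y : pseries B.

Lemma coefs_pmul x y i :
  coefs (x * y) i = \sum_(j < i.+1) coefs x (i - j)%N * coefs y j.
Proof.
apply: eq_bigr => j _; congr (_ * _).
by move: (coefs x _) => b; elim: (nat_of_ord j) => //= k ->.
Qed.

Lemma coef0_pmul x y : coefs (x * y) 0 = coefs x 0 * coefs y 0.
Proof. by rewrite coefs_pmul big_ord1. Qed.

Lemma coefs_pconstM (b : B) x i : coefs (pconst b * x) i = b * coefs x i.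
Proof.
rewrite coefs_pmul big_ord_recr /= subnn big1 ?add0r //= => j _.
by rewrite subn_eq0 leqNgt ltn_ord /= mul0r.
Qed.

Lemma coefs_Mpconst (b : B) x i : coefs (x * pconst b) i = coefs x i * b.
Proof.
rewrite coefs_pmul big_ord_recl /= subn0 big1 ?addr0 //= => j _.
by rewrite mulr0.
Qed.

Lemma pX_comm x : skew_X (id_rmorph B) * x = x * skew_X (id_rmorph B).
Proof.
apply: skew_seriesP => i; rewrite !coefs_pmul.
case: i => [|i]; first by rewrite !big_ord1 mulr0 mul0r.
rewrite [RHS]big_ord_recl [X in _ + X]big_ord_recl /= mulr0 add0r mulr1.
rewrite subSS subn0 [X in _ + X]big1 ?addr0 => [|j _]; last by rewrite mulr0.
rewrite 2!big_ord_recr /= subnn mul0r addr0 subSnn mul1r big1 ?add0r // => j _.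
by rewrite subSn 1?ltnW //= eqSS subn_eq0 leqNgt ltn_ord mul0r.
Qed.

Fact pconst_is_zmod_morphism : zmod_morphism (@pconst B).
Proof. by move=> a b; apply: skew_seriesP => -[|i] /=; rewrite ?subr0. Qed.
Fact pconst_is_monoid_morphism : monoid_morphism (@pconst B).
Proof.
split=> [|a b]; first by apply: skew_seriesP => -[|i].
by apply: skew_seriesP => -[|i]; rewrite coefs_pconstM //= mulr0.
Qed.
HB.instance Definition _ :=
  GRing.isZmodMorphism.Build B (pseries B) (@pconst B) pconst_is_zmod_morphism.
HB.instance Definition _ :=
  GRing.isMonoidMorphism.Build B (pseries B) (@pconst B)
    pconst_is_monoid_morphism.

Lemma pconst_inj : injective (@pconst B).
Proof. by move=> a b /(congr1 (fun x : pseries B => coefs x 0)). Qed.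

End PowerSeries.

(** * Nilpotent and unipotent elements *)

Section Nilpotent.
Variable B : pzRingType.
Implicit Types x y : B.

Lemma nilpotent_sub1_inverse x : nilpotent x ->
  exists y, mutual_inverse (1 - x) y.
Proof.
case=> n xn; exists (\sum_(i < n) x ^+ i); split.
  by apply: oppr_inj; rewrite -mulNr opprB -subrX1 xn sub0r.
have -> : (\sum_(i < n) x ^+ i) * (1 - x) = (1 - x) * (\sum_(i < n) x ^+ i).
  apply: commr_sym; apply: commr_sum => i _; apply: commr_sym.
  by apply: commrB; [apply: commr1|apply: commr_sym; apply: commrX].
by apply: oppr_inj; rewrite -mulNr opprB -subrX1 xn sub0r.
Qed.

(* [(e - 1) f = f (c e - 1)], where [c e - 1] is a unit because [e] is unipotent
   and [c - 1] is a unit. *)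
Lemma unipotent_qcommute_eq0 (c c' e f : B) :
  (forall x, c * x = x * c) -> (c - 1) * c' = 1 -> nilpotent (e - 1) ->
  e * f = c * f * e -> f = 0.
Proof.
move=> cC cc' [n en] ef.
have c1C x : (c - 1) * x = x * (c - 1) by rewrite mulrBl mulrBr mul1r mulr1 cC.
have c'c : c' * (c - 1) = 1 by rewrite -c1C.
have c'C x : c' * x = x * c'.
  by rewrite -[c' * x]mulr1 -cc' mulrA -[c' * x * _]mulrA -c1C !mulrA c'c mul1r.
set u := c * e - 1.
(* Since u = (c-1) + c(e-1), dividing by the central unit c-1 leaves 1 plus a nilpotent element, and
   w is its inverse. *)
have [|w [uw _]] := @nilpotent_sub1_inverse (- (c' * c) * (e - 1)).
  exists n; rewrite exprMn_comm ?en ?mulr0 //.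
  by rewrite /GRing.comm mulNr mulrN -mulrA cC mulrA c'C -mulrA.
have uE : u = (c - 1) * (1 - - (c' * c) * (e - 1)).
  rewrite mulNr opprK mulrDr mulr1 !mulrA cc' mul1r mulrBr mulr1.
  by rewrite addrC addrA subrK.
have uK : u * (w * c') = 1 by rewrite uE -mulrA [_ * (w * c')]mulrA uw mul1r.
have NfE k : (e - 1) ^+ k * f = f * u ^+ k.
  elim: k => [|k IH]; first by rewrite !expr0 mul1r mulr1.
  have Nf : (e - 1) * f = f * u.
    by rewrite mulrBl mulrBr mul1r mulr1 ef cC mulrA.
  by rewrite exprSr -mulrA Nf mulrA IH -mulrA -exprSr.
have {NfE} : f * u ^+ n = 0 by rewrite -NfE en mul0r.
elim: n {en} => [|n IH]; first by rewrite expr0 mulr1.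
by move/(congr1 (fun x => x * (w * c'))); rewrite exprSr -!mulrA uK mul0r mulr1.
Qed.

End Nilpotent.

(** * Recurrences with central scalars *)

Section Recurrences.
Variables (C : fieldType) (B : pzRingType) (h : {rmorphism C -> B}).
Hypothesis hC : forall c x, h c * x = x * h c.

Lemma scalar_mulI c (x y : B) : c != 0 -> h c * x = h c * y -> x = y.
Proof.
move=> c0 /(congr1 (fun x => h c^-1 * x)).
by rewrite !mulrA -!rmorphM mulVf // rmorph1 !mul1r.
Qed.

Lemma geometric_rec (z : nat -> B) (a c : C) n : a != 0 ->
  (forall n, h a * z n.+1 = h c * z n) -> z n = h ((c / a) ^+ n) * z 0.
Proof.
move=> a0 zS; elim: n => [|n IH]; first by rewrite expr0 rmorph1 mul1r.
apply: (scalar_mulI a0); rewrite zS IH !mulrA -!rmorphM exprS mulrA.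
by rewrite [a * (c / a)]mulrC divfK.
Qed.

Variables q qa : C.
Hypothesis q_neq0 : q != 0.
Hypothesis q_not_root : forall n, (0 < n)%N -> q ^+ n != 1.

(** Splitting [alpha] cancels the [i] terms and leaves a q^i [i+1] z_(i+1) = q^i [alpha-i] z_i,
    which the left inverse v of a solves for z_(i+1). *)
Lemma qbinomial_rec (z : nat -> B) (a v : B) i : v * a = 1 ->
  (forall i, a * h (q ^+ i) * (h (qnat q i.+1) * z i.+1) + h (qnat q i) * z i =
     h (qnumber q qa) * z i) ->
  z i = h (qbinom_gen q qa i) * (v ^+ i * z 0).
Proof.
move=> va zS; elim: i => [|i IH].
  by rewrite qbinom_gen0 expr0 rmorph1 !mul1r.
have rec : h (qnat q i.+1) * z i.+1 = h (qnumber q (qa / q ^+ i)) * (v * z i).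
  have := zS i; rewrite (qnumber_shift q_not_root qa i q_neq0) rmorphD.
  rewrite mulrDl [RHS]addrC => /addIr; rewrite -hC rmorphM -!mulrA.
  move/(scalar_mulI (expf_neq0 i q_neq0))/(congr1 (fun x => v * x)).
  by rewrite mulrA va mul1r => ->; rewrite mulrA -hC mulrA.
apply: (scalar_mulI (qnat_neq0 q_not_root i)).
have vh c w : v * (h c * w) = h c * (v * w) by rewrite mulrA -hC mulrA.
rewrite rec IH vh [v * (_ * _)]mulrA -exprS !mulrA -!rmorphM -qbinom_genS //.
by rewrite [qnat _ _ * _]mulrC.
Qed.

End Recurrences.

(** * The shape of a deformation *)

Section Deformation.
Variables (C : fieldType) (q qa : C).
Local Notation L := (funfield C).
Local Notation hull := (hull q qa).
Local Notation tL := (tL C).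
Local Notation yL := (yL C).
Local Notation cstL := (@cstL C).
Local Notation hull_Q := (hull_Q q qa).
Local Notation hull_X := (hull_X q qa).
Local Notation hull_Y0 := (hull_Y0 q qa).
Local Notation hull_cst := (hull_cst q qa).

Section Coordinates.
Variables (A : ncalg L) (phi : NCF q qa A).

(** The coordinates are read at X^0 and n = 0, where Q has value 1 and X contributes nothing.
    [def_b] drops only W2, so a series in W1 remains. *)
Definition def_e : A := coefs (coefs (coefs (phi hull_Q) 0 0) 0) 0.
Definition def_f : A := coefs (coefs (coefs (phi hull_X) 0 0) 0) 0.
Definition def_b : pseries A := coefs (coefs (phi hull_Y0) 0 0) 0.

End Coordinates.

Hypothesis q_neq0 : q != 0.
Hypothesis qa_neq0 : qa != 0.
Hypothesis q_not_root : forall n, (0 < n)%N -> q ^+ n != 1.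
Hypothesis natC_neq0 : forall n, n.+1%:R != 0 :> C.

Section Algebra.
Variable A : ncalg L.
Local Notation str := (ncalg_str A).
Local Notation cst2 := (@cst2 C A).
Local Notation const2 := (@const2 C A).

Definition scal : {rmorphism C -> A} := comp_rmorph str cstL.
Definition scal2 : {rmorphism C -> pseries2 A} :=
  comp_rmorph (@pconst (pseries A)) (comp_rmorph (@pconst A) scal).

Lemma cst2E c : cst2 c = scal2 c. Proof. by []. Qed.

Lemma scalC c x : scal c * x = x * scal c.
Proof. exact: ncalg_central. Qed.

Lemma cst2C c z : cst2 c * z = z * cst2 c.
Proof.
apply: skew_seriesP => j; rewrite coefs_pconstM coefs_Mpconst.
apply: skew_seriesP => i; rewrite coefs_pconstM coefs_Mpconst.
exact: ncalg_central.
Qed.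

Lemma cst2_1 : cst2 1 = 1.
Proof. exact: (rmorph1 scal2). Qed.

(** A is an algebra over C, in which n + 1 is invertible. *)
Lemma mulrSn_eq0 (x : A) n : x *+ n.+1 = 0 -> x = 0.
Proof.
move=> xn; have : scal n.+1%:R^-1 * (x *+ n.+1) = 0 by rewrite xn mulr0.
by rewrite -[x *+ _]mulr_natl mulrA -(rmorph_nat scal) -rmorphM mulVf //
  rmorph1 mul1r.
Qed.

Lemma coefsMn (B : pzRingType) (z : pseries B) n i :
  coefs (z *+ n) i = coefs z i *+ n.
Proof. by elim: n => [|n IH]; rewrite ?mulr0n // !mulrS /= IH. Qed.

Lemma dW2_eq0 (z : pseries2 A) : dW2 z = 0 -> z = pconst (coefs z 0).
Proof.
move=> z2; apply: skew_seriesP => -[|j] //=; apply: skew_seriesP => i.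
apply: (@mulrSn_eq0 _ j); rewrite -coefsMn.
exact: (congr1 (fun z : pseries2 A => coefs (coefs z j) i) z2).
Qed.

Lemma dW_eq0 (z : pseries2 A) : dW1 z = 0 -> dW2 z = 0 ->
  z = const2 (coefs (coefs z 0) 0).
Proof.
move=> z1 /dW2_eq0 ->; congr pconst; apply: skew_seriesP => -[|i] //=.
apply: (@mulrSn_eq0 _ i).
exact: (congr1 (fun z : pseries2 A => coefs (coefs z 0) i) z1).
Qed.

Lemma iter_dt0 n : iter n (@dt C) 0 = 0.
Proof. by elim: n => //= n ->; apply: dt0. Qed.
Lemma iter_dy0 n : iter n (@dy C) 0 = 0.
Proof. by elim: n => //= n ->; apply: dy0. Qed.

Lemma coefs_taylor a i j : coefs (coefs (taylor A a) j) i =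
  str ((i`! * j`!)%:R^-1 * iter i (@dt C) (iter j (@dy C) a)).
Proof. by []. Qed.

Lemma taylor00 a : coefs (coefs (taylor A a) 0) 0 = str a.
Proof. by rewrite coefs_taylor /= fact0 muln1 invr1 mul1r. Qed.

Lemma taylor_cst c : taylor A (cstL c) = cst2 c.
Proof.
apply: skew_seriesP => j; apply: skew_seriesP => i.
case: j => [|j]; last first.
  by rewrite coefs_taylor iterSr dy_cst iter_dy0 iter_dt0 mulr0 rmorph0.
case: i => [|i]; first exact: taylor00.
by rewrite coefs_taylor /= -iterS iterSr dt_cst iter_dt0 mulr0 rmorph0.
Qed.

Definition tW1 : pseries A := pconst (str tL) + skew_X (id_rmorph A).

Lemma taylor_tL : taylor A tL = pconst tW1.
Proof.
apply: skew_seriesP => j; apply: skew_seriesP => i.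
case: j => [|j]; last first.
  by rewrite coefs_taylor iterSr dy_tL iter_dy0 iter_dt0 mulr0 rmorph0.
case: i => [|[|i]]; first by rewrite taylor00 /= addr0.
  by rewrite coefs_taylor /= dt_tL muln1 invr1 mul1r rmorph1 add0r.
rewrite coefs_taylor /= -!iterS 2!iterSr dt_tL -cstL1 dt_cst iter_dt0.
by rewrite mulr0 rmorph0 addr0.
Qed.

Lemma tW1C b : tW1 * pconst b = pconst b * tW1.
Proof.
rewrite mulrDl mulrDr pX_comm; congr (_ + _).
by rewrite -!(rmorphM (@pconst A)) ncalg_central.
Qed.

Lemma affine_actE (e f : A) : affine_act e f = pconst e * tW1 + pconst f.
Proof. by []. Qed.

Variable phi : NCF q qa A.
Local Notation e := (def_e phi).
Local Notation f := (def_f phi).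
Local Notation b := (def_b phi).

Lemma phi_Sigma x i n :
  coefs (phi (hull_Sigma x)) i n = cst2 (q ^+ i) * coefs (phi x) i n.+1.
Proof. by case: (ncfP phi) => -[-> _]. Qed.

Lemma phi_Theta l x : phi (hull_Theta l x) = hatTheta q cst2 l (phi x).
Proof. by case: (ncfP phi) => -[_ ->]. Qed.

(** As binom(l, l)_q = 1, the coefficient of X^l becomes the X^0 term after [hull_Theta l]; this
    gives access to all higher coefficients. *)
Lemma phi_Theta0 l x n :
  coefs (phi (hull_Theta l x)) 0 n = coefs (phi x) l n.
Proof.
by rewrite phi_Theta /= add0n qbinomnn // cst2_1 mul1r.
Qed.

Lemma phi_cst a : phi (hull_cst a) = tconst (taylor A a).
Proof.
case: (ncfP phi) => _ _ _ phiK _; rewrite (phiK a) //.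
apply: tseriesP => -[|i] n //=.
by rewrite -[0 n]cstL0 taylor_cst; apply: (rmorph0 scal2).
Qed.

#[local] Opaque Defs.cst2.

Lemma phi_scal c : phi (hull_cst (cstL c)) = tconst (cst2 c).
Proof. by rewrite phi_cst taylor_cst. Qed.

(** On X^i the eigenvalue equation reads q^i z_(n+1) = c z_n, a geometric recurrence in n. *)
Lemma phi_eigen x c i n : hull_Sigma x = hull_cst (cstL c) * x ->
  coefs (phi x) i n = cst2 ((c / q ^+ i) ^+ n) * coefs (phi x) i 0.
Proof.
move=> xS; apply: (@geometric_rec _ _ scal2 (coefs (phi x) i)) => [|m].
  exact: expf_neq0.
by rewrite -!cst2E -phi_Sigma xS rmorphM phi_scal coefs_tconstM.
Qed.

Lemma phi_dt0 x i n : hull_dt x = 0 -> dW1 (coefs (phi x) i n) = 0.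
Proof.
move=> x0; case: (ncfP phi) => _ phit _ _ _; have := phit x.
by rewrite x0 rmorph0 => /(congr1 (fun z : tseries _ => coefs z i n)).
Qed.
Lemma phi_dy0 x i n : hull_dy x = 0 -> dW2 (coefs (phi x) i n) = 0.
Proof.
move=> x0; case: (ncfP phi) => _ _ phiy _ _; have := phiy x.
by rewrite x0 rmorph0 => /(congr1 (fun z : tseries _ => coefs z i n)).
Qed.

Lemma phi_Q : phi hull_Q = tconst (const2 e) * tQ cst2 q.
Proof.
apply: tseriesP => i n; rewrite coefs_tconstM; case: i => [|i]; last first.
  by rewrite -phi_Theta0 hull_Theta_Q // rmorph0 [RHS]mulr0.
rewrite (@phi_eigen _ q) ?expr0 ?divr1 ?hull_Sigma_Q // cst2C.
by rewrite [coefs _ 0 0]dW_eq0 ?phi_dt0 ?phi_dy0 ?hull_dt_Q ?hull_dy_Q.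
Qed.

Lemma phi_X : phi hull_X = tX + tconst (const2 f) * tQ cst2 q.
Proof.
apply: tseriesP => i n; rewrite coefsD coefs_tconstM.
case: i => [|[|i]].
- rewrite (@phi_eigen _ q) ?expr0 ?divr1 ?hull_Sigma_X // cst2C [RHS]add0r.
  by rewrite [coefs _ 0 0]dW_eq0 ?phi_dt0 ?phi_dy0 ?hull_dt_X ?hull_dy_X.
- by rewrite -phi_Theta0 hull_Theta1_X // rmorph1 mulr0 [RHS]addr0.
- by rewrite -phi_Theta0 hull_Theta_X // rmorph0 mulr0 [RHS]addr0.
Qed.

(** Taking the constant term in X, W1 and W2 at n = 0 is multiplicative, so a q-commutation relation
    descends to A. *)
Lemma coef0_qcommute (x y : tseries (pseries2 A)) c :
  x * y = tconst (cst2 c) * (y * x) ->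
  let cf (z : tseries (pseries2 A)) := coefs (coefs (coefs z 0 0) 0) 0 in
  cf x * cf y = scal c * cf y * cf x.
Proof.
move=> xy /=; have := congr1 (fun z : tseries _ => coefs z 0 0) xy.
rewrite coefs_tconstM !coef0_tmul.
move: (coefs x 0 0) (coefs y 0 0) => u v /(congr1 (fun z => coefs (coefs z 0)
  0)).
by rewrite coefs_pconstM coefs_pconstM !coef0_pmul mulrA.
Qed.

Lemma def_ef : e * f = scal q * f * e.
Proof.
apply: coef0_qcommute.
by rewrite -phi_scal -!rmorphM hull_QX.
Qed.

Lemma nil_coef x i n j1 j2 :
  nilpotent (coefs (coefs (coefs (phi x) i n) j2) j1 -
  coefs (coefs (taylor A (coefs (val x) i n)) j2) j1).
Proof. by case: (ncfP phi) => _ _ _ _ /(_ x i n j1 j2). Qed.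

Lemma def_e_unipotent : nilpotent (e - 1).
Proof.
have := nil_coef hull_Q 0 0 0 0; rewrite val_hull_Q // taylor00 /=.
by rewrite expr0 cstL1 rmorph1.
Qed.

Lemma def_f_eq0 : f = 0.
Proof.
apply: (@unipotent_qcommute_eq0 _ (scal q) (scal (q - 1)^-1) e) => //.
- exact: scalC.
- by rewrite -(rmorph1 scal) -rmorphB -rmorphM mulfV // q_sub1_neq0.
- exact: def_e_unipotent.
- exact: def_ef.
Qed.

Lemma def_b_unipotent i : nilpotent (coefs (b - 1) i).
Proof.
have := nil_coef hull_Y0 0 0 i 0; rewrite val_hull_Y0 // coefs_Y0.
rewrite qbinom_gen0 !expr0 !mulr1 taylor_cst cst2_1.
by case: i.
Qed.

Lemma def_e_unit : exists e', mutual_inverse e e'.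
Proof.
have [|e' ee'] := @nilpotent_sub1_inverse _ (1 - e); last first.
  by exists e'; rewrite subKr in ee'.
by case: def_e_unipotent => n en; exists n; rewrite -opprB exprNn en mulr0.
Qed.

(** On constants [phi] is given by [taylor], so this is inherited from the ring morphism [phi], with
    no Leibniz rule for iterated derivatives. *)
Lemma taylor_mul_eq1 a a' : a * a' = 1 -> taylor A a * taylor A a' = 1.
Proof.
move=> aa'; have : phi (hull_cst a * hull_cst a') = 1.
  rewrite -(rmorph1 phi); congr (phi _); apply: val_inj.
  rewrite hull_valM; apply: tseriesP => i n; rewrite coefs_tconstM.
  by case: i => [|i]; [apply: aa'|apply: mulr0].
rewrite rmorphM !phi_cst => /(congr1 (fun z : tseries _ => coefs z 0 0)).
by rewrite coefs_tconstM.
Qed.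

(** The Taylor expansion of t is free of W2, so the W2-free part of the expansion of t^-1 already
    inverts it. *)
Lemma tW1_unit : exists w, mutual_inverse tW1 w.
Proof.
exists (coefs (taylor A tL^-1) 0); split.
- have /(congr1 (fun z : pseries2 A => coefs z 0)) :=
    taylor_mul_eq1 (mulfV (tL_neq0 C)).
  by rewrite taylor_tL coefs_pconstM.
- have /(congr1 (fun z : pseries2 A => coefs z 0)) :=
    taylor_mul_eq1 (mulVf (tL_neq0 C)).
  by rewrite taylor_tL coefs_Mpconst.
Qed.

(** As f = 0, the element is the product of the units e and t + W1. *)
Lemma affine_act_unit : exists v, mutual_inverse (affine_act e f) v.
Proof.
have [w [Tw wT]] := tW1_unit; have [e' [ee' e'e]] := def_e_unit.
have pe : pconst e * pconst e' = 1 by rewrite -rmorphM ee' rmorph1.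
have pe' : pconst e' * pconst e = 1 by rewrite -rmorphM e'e rmorph1.
exists (w * pconst e'); rewrite affine_actE def_f_eq0 rmorph0 addr0; split.
  by rewrite mulrA -[_ * tW1 * w]mulrA Tw mulr1.
by rewrite -mulrA [pconst e' * _]mulrA pe' mul1r.
Qed.

Lemma phi_iota_tL : phi (hull_iota q qa tL) =
  tfun (fun n => pconst (affine_act e f) * cst2 (q ^+ n)) + tX.
Proof.
rewrite hull_iota_tL rmorphD rmorphM phi_cst taylor_tL phi_Q phi_X.
rewrite [tX + _]addrC addrA; congr (_ + _).
rewrite mulrA -(rmorphM (@tconst _)) -mulrDl -(rmorphD (@tconst _)).
(* Here e moves past t + W1, since t is central in A and W1 is a central variable. *)
have -> : pconst tW1 * const2 e + const2 f = pconst (affine_act e f).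
  rewrite affine_actE -tW1C; apply: esym.
  apply: etrans (rmorphD (@pconst (pseries A)) _ _) _; congr (_ + _).
  exact: (rmorphM (@pconst (pseries A))).
exact: tconstM_tfun.
Qed.

(** The eigenvalue fixes the dependence on n, and the vanishing y-derivative removes W2, so only the
    series [b] in W1 is left free. *)
Lemma phi_Y0_scalar n : coefs (phi hull_Y0) 0 n = cst2 (qa ^+ n) * pconst b.
Proof.
rewrite (@phi_eigen _ qa) ?expr0 ?divr1 ?hull_Sigma_Y0 //; congr (_ * _).
by rewrite [LHS]dW2_eq0 ?phi_dy0 ?hull_dy_Y0.
Qed.

(** Compare the X^0 coefficients at n = 0 in the commutation of iota t with [Y0]; the summand X does
    not reach them. *)
Lemma def_b_comm : affine_act e f * b = b * affine_act e f.
Proof.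
have : phi (hull_iota q qa tL) * phi hull_Y0 =
    phi hull_Y0 * phi (hull_iota q qa tL).
  by rewrite -!(rmorphM phi) hull_iota_tL_comm_Y0.
rewrite phi_iota_tL => /(congr1 (fun z : tseries _ => coefs z 0 0)).
rewrite coef0_tmul [RHS]coef0_tmul phi_Y0_scalar coefsD addr0 /=.
rewrite expr0 cst2_1 mulr1 mul1r.
by rewrite -!(rmorphM (@pconst _)) => /pconst_inj.
Qed.

Lemma phi_Y0 v : v * affine_act e f = 1 ->
  phi hull_Y0 = tbinomial q cst2 qa (pconst v) (pconst b).
Proof.
move=> va.
(* At n = 0 the image of the q-difference equation for [Y0] is exactly the recurrence in i solved by
   [qbinomial_rec]. *)
have zE i : coefs (phi hull_Y0) i 0 =
    cst2 (qbinom_gen q qa i) * (pconst v ^+ i * pconst b).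
  rewrite -[pconst b]mul1r -cst2_1 -(phi_Y0_scalar 0).
  apply: (@qbinomial_rec _ _ scal2 _ q qa _ _ (fun i => coefs (phi hull_Y0) i 0)
    (pconst (affine_act e f))) => // [c z||j].
  - exact: cst2C.
  - by rewrite -(rmorphM (@pconst _)) va rmorph1.
  have : phi (hull_iota q qa tL) * phi (hull_Theta 1 hull_Y0) =
      phi (hull_cst (cstL (qnumber q qa))) * phi hull_Y0.
    by rewrite -!(rmorphM phi) hull_iota_tL_Y0.
  rewrite phi_scal phi_iota_tL phi_Theta.
  move=> /(congr1 (fun z : tseries _ => coefs z j 0)).
  by rewrite (@coefs_linear_hatTheta1 _ _ q scal2) // coefs_tconstM add0n.
(* The eigenvalue of [Y0] carries the formula from n = 0 to every n. *)
apply: tseriesP => i n; rewrite (@phi_eigen _ qa) ?hull_Sigma_Y0 // zE.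
by rewrite [LHS]cst2C [RHS]/= -!mulrA -[pconst b * _]cst2C.
Qed.

End Algebra.
End Deformation.

(** * Injectivity *)

(** The morphism laws are propositions, so by proof irrelevance only the underlying functions
    matter. *)
Lemma rmorphism_ext (R S : pzSemiRingType) (f g : {rmorphism R -> S}) :
  f =1 g -> f = g.
Proof.
case: f g => f [[f0] [f1]] [g [[g0] [g1]]] /= /funext fg.
by case: g / fg g0 g1 => g0 g1;
  rewrite (Prop_irrelevance f0 g0) (Prop_irrelevance f1 g1).
Qed.

Section Representation.
Variables (C : fieldType) (q qa : C).
Local Notation L := (funfield C).
Local Notation hull := (hull q qa).
Local Notation tL := (tL C).
Local Notation yL := (yL C).
Local Notation cstL := (@cstL C).
Local Notation hull_Q := (hull_Q q qa).
Local Notation hull_X := (hull_X q qa).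
Local Notation hull_Y0 := (hull_Y0 q qa).
Local Notation hull_cst := (hull_cst q qa).
Local Notation hull_iota := (hull_iota q qa).

Hypothesis q_neq0 : q != 0.
Hypothesis qa_neq0 : qa != 0.
Hypothesis q_not_root : forall n, (0 < n)%N -> q ^+ n != 1.
Hypothesis natC_neq0 : forall n, n.+1%:R != 0 :> C.

Lemma NCF_ext (A : ncalg L) (phi psi : NCF q qa A) : phi =1 psi -> phi = psi.
Proof.
case: phi psi => f fP [g gP] /= /rmorphism_ext fg.
by case: g / fg gP => gP; rewrite (Prop_irrelevance fP gP).
Qed.

Lemma affine_mx_inj (A : ncalg L) (e f e' f' : A) :
  affine_mx e f = affine_mx e' f' -> e = e' /\ f = f'.
Proof.
move=> /(@eq_block_mx _ 1 1 1 1) [/matrixP/(_ 0 0) ee /matrixP/(_ 0 0) ff _ _].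
by move: ee ff; rewrite !mxE.
Qed.

(** * The map to the target functor *)

Section Psi.
Variables (A : ncalg L) (phi : NCF q qa A).

Lemma psi_subproof : is_QG q (affine_mx (def_e phi) (def_f phi), def_b phi).
Proof.
exists (def_e phi), (def_f phi); split => //=.
(* With f = 0 both sides of the commutation relation vanish. *)
- split; first by rewrite def_f_eq0 // !mulr0 mul0r.
  exact: def_e_unit.
- by rewrite def_b_comm // subrr.
- split; first exact: def_e_unipotent.
  by rewrite def_f_eq0 //; exists 1%N; rewrite expr1.
- exact: def_b_unipotent.
Qed.

Definition psi : QG q A := MkQG psi_subproof.

Lemma psi_determined e f b :
  qg_val psi = (affine_mx e f, b) <-> determined_by phi e f b.
Proof.
split=> [[/affine_mx_inj [<- <-] <-]|].
  have [v [av va]] := affine_act_unit q_neq0 qa_neq0 q_not_root phi.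
  split; last exists v => //.
  - by exists hull_Q; [apply: val_hull_Q|apply: phi_Q].
  - by exists hull_X; [apply: val_hull_X|apply: phi_X].
  - by exists hull_Y0; [apply: val_hull_Y0|apply: phi_Y0].
(* A hull element is determined by its underlying series, so [sends] is single-valued; the
   coordinates are then read off at X^0 and n = 0. *)
have sendsE x y u : val u = x -> sends phi x y -> phi u = y.
  by move=> <- [u' /val_inj -> ].
case=> /(sendsE _ _ _ (val_hull_Q q_neq0 qa_neq0 q_not_root)) pQ.
move=> /(sendsE _ _ _ (val_hull_X q_neq0 qa_neq0 q_not_root)) pX.
case=> v _ /(sendsE _ _ _ (val_hull_Y0 q_neq0 qa_neq0)) pY.
congr (affine_mx _ _, _).
- by rewrite /def_e pQ coefs_tconstM -[coefs _ 0 0]/(cst2 A 1) cst2_1 mulr1.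
- rewrite /def_f pX coefsD coefs_tconstM -[coefs (tQ _ _) 0 0]/(cst2 A 1).
  by rewrite cst2_1 mulr1 /= add0r.
- rewrite /def_b pY -[coefs (tbinomial _ _ _ _ _) 0 0]/(cst2 A _ *
    pconst v ^+ 0 * cst2 A ((qa / q ^+ 0) ^+ 0) * pconst b).
  by rewrite qbinom_gen0 !expr0 !cst2_1 !mul1r.
Qed.

End Psi.

(** The coordinates of a deformation are coefficients, and the induced map applies g to
    coefficients. *)
Lemma psi_map (A B : ncalg L) (g : ncalg_hom A B) (phi : NCF q qa A) :
  psi (NCF_map g phi) = QG_map g (psi phi).
Proof.
have QG_ext (x y : QG q B) : qg_val x = qg_val y -> x = y.
  case: x y => x xP [y yP] /= xy.
  by case: y / xy yP => yP; rewrite (Prop_irrelevance xP yP).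
by apply: QG_ext; rewrite /= map_affine_mx.
Qed.

(** * Deformations with the same image *)

Section Injectivity.
Variables (A : ncalg L) (phi phi' : NCF q qa A).
Hypothesis psi_eq : psi phi = psi phi'.
Let same u := phi u = phi' u.

Lemma same_generators : [/\ same hull_Q, same hull_X & same hull_Y0].
Proof.
have [/affine_mx_inj [ee ff] bb] := congr1 (@qg_val _ _ _) psi_eq.
have [v [av va]] := affine_act_unit q_neq0 qa_neq0 q_not_root phi.
pose QE := phi_Q q_neq0 qa_neq0 q_not_root natC_neq0.
pose XE := phi_X q_neq0 qa_neq0 q_not_root natC_neq0.
pose YE := @phi_Y0 _ _ _ q_neq0 qa_neq0 q_not_root natC_neq0 A.
split.
- by apply: etrans (QE _ phi) (etrans _ (esym (QE _ phi'))); rewrite ee.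
- by apply: etrans (XE _ phi) (etrans _ (esym (XE _ phi'))); rewrite ff.
- apply: etrans (YE phi v va) (etrans _ (esym (YE phi' v _))).
    by rewrite bb.
  by rewrite -ee -ff.
Qed.

Lemma same_sub u v : same u -> same v -> same (u - v).
Proof. by move=> su sv; rewrite /same !rmorphB su sv. Qed.
Lemma same_add u v : same u -> same v -> same (u + v).
Proof. by move=> su sv; rewrite /same !rmorphD su sv. Qed.
Lemma same_mul u v : same u -> same v -> same (u * v).
Proof. by move=> su sv; rewrite /same !rmorphM su sv. Qed.
Lemma same_inv u v : u * v = 1 -> v * u = 1 -> same u -> same v.
Proof.
move=> uv vu su; rewrite /same -[LHS]mulr1 -(rmorph1 phi') -uv rmorphM -su.
by rewrite mulrA -rmorphM vu rmorph1 mul1r.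
Qed.

Lemma same_cst a : same (hull_cst a).
Proof. by rewrite /same !phi_cst. Qed.

Lemma hull_iotaD a b : hull_iota (a + b) = hull_iota a + hull_iota b.
Proof. by apply: val_inj; apply: (iota_addr q_neq0 qa_neq0). Qed.
Lemma hull_iotaM a b : hull_iota (a * b) = hull_iota a * hull_iota b.
Proof. by apply: val_inj; apply: (iota_mulr q_neq0 qa_neq0 q_not_root). Qed.
Lemma hull_iota_cst c : hull_iota (cstL c) = hull_cst (cstL c).
Proof. by apply: val_inj; apply: iota_cst. Qed.
Lemma hull_iota1 : hull_iota 1 = 1.
Proof. by apply: val_inj; apply: iota_one. Qed.

Lemma same_iota a : same (hull_iota a).
Proof.
have [sQ sX sY] := same_generators.
have sD a' b : same (hull_iota a') -> same (hull_iota b) ->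
  same (hull_iota (a' + b)).
  by rewrite hull_iotaD; apply: same_add.
have sM a' b : same (hull_iota a') -> same (hull_iota b) ->
  same (hull_iota (a' * b)).
  by rewrite hull_iotaM; apply: same_mul.
have sC c : same (hull_iota (cstL c)) by rewrite hull_iota_cst; apply: same_cst.
have st : same (hull_iota tL).
  by rewrite hull_iota_tL; apply: same_add sX; apply: same_mul sQ;
    apply: same_cst.
have sy : same (hull_iota yL).
  by rewrite hull_iota_yL //; apply: same_mul sY _; apply: same_cst.
(* Polynomials in t come first, then polynomials in y over them; denominators are settled by
   uniqueness of inverses. *)
have s1 (p : {poly C}) : same (hull_iota p%:P%:F).
  elim/poly_ind: p => [|p c IH]; first exact: (sC 0).
  by rewrite polyCD polyCM tofracD tofracM; apply: sD (sC c); apply: sM st.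
have s2 (p : {poly {poly C}}) : same (hull_iota p%:F).
  elim/poly_ind: p => [|p c IH]; first exact: (sC 0).
  by rewrite tofracD tofracM; apply: sD (s1 c); apply: sM sy.
rewrite [a]repr_fracE; apply: (sM _ _ (s2 _)).
set m := (\d_ _)%:F; have m0 : m != 0 by rewrite tofrac_eq0 denom_ratioP.
apply: (@same_inv (hull_iota m)).
- by rewrite -hull_iotaM mulfV // hull_iota1.
- by rewrite -hull_iotaM mulVf // hull_iota1.
- exact: s2.
Qed.

Lemma same_all u : same u.
Proof.
have [[phiS phiT] phit phiy _ _] := ncfP phi.
have [[phiS' phiT'] phit' phiy' _ _] := ncfP phi'.
(* S is a stable subring of series containing the generators, so it contains the hull, which is the
   smallest one. *)
pose S (x : tseries L) := exists2 v : hull, val v = x & same v.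
suff [v /val_inj -> //] : S (val u).
apply: hull_valP; split; last first.
  by move=> x [[a _ <-]|[a _ <-]];
    [exists (hull_iota a); last exact: same_iota
    |exists (hull_cst a); last exact: same_cst].
split; first split.
- by exists 1; rewrite /same ?rmorph1.
- move=> _ _ [v <- sv] [w <- sw]; exists (v - w) => //; exact: same_sub.
- move=> _ _ [v <- sv] [w <- sw]; exists (v * w) => //; exact: same_mul.
- by move=> _ [v <- sv]; exists (hull_Sigma v); rewrite /same ?phiS ?phiS' ?sv.
- by move=> l _ [v <- sv]; exists (hull_Theta l v);
  rewrite /same ?phiT ?phiT' ?sv.
- by move=> _ [v <- sv]; exists (hull_dt v); rewrite /same ?phit ?phit' ?sv.
- by move=> _ [v <- sv]; exists (hull_dy v); rewrite /same ?phiy ?phiy' ?sv.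
Qed.

Lemma psi_inj_subproof : phi = phi'.
Proof. exact: NCF_ext same_all. Qed.

End Injectivity.

End Representation.

(** The real exponential is positive, and cosine and sine do not vanish together since their squares
    sum to 1. It makes q^alpha nonzero. *)
Lemma cexp_neq0 (R : realType) (z : R[i]) : cexp z != 0.
Proof.
apply/negP => /eqP [] /eqP;
  rewrite mulf_eq0 Order.POrderTheory.gt_eqF ?exp.expR_gt0 //= => /eqP cz.
move=> /eqP; rewrite mulf_eq0 Order.POrderTheory.gt_eqF ?exp.expR_gt0 //= =>
  /eqP sz.
have := trigo.cos2Dsin2 (complex.Im z); rewrite cz sz expr0n addr0 => /eqP.
by rewrite eq_sym oner_eq0.
Qed.

Theorem proposition5p11 (R : realType) (q alpha qa : R[i])
    (q_neq0 : q != 0)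
    (q_not_root : forall n : nat, (0 < n)%N -> q ^+ n != 1)
    (alpha_irrational : forall r : rat, alpha != ratr r)
    (qaP : power_value q alpha qa) :
  exists Psi : forall A : ncalg (funfield R[i]), NCF q qa A -> QG q A,
  [/\ forall A, injective (Psi A),
      forall (A B : ncalg (funfield R[i])) (g : ncalg_hom A B) (phi : NCF q qa A),
        Psi B (NCF_map g phi) = QG_map g (Psi A phi)
    & forall (A : ncalg (funfield R[i])) (phi : NCF q qa A)
             (e f : A) (b0 : pseries A),
        qg_val (Psi A phi) = (affine_mx e f, b0) <-> determined_by phi e f b0].
Proof.
have qa_neq0 : qa != 0 by case: qaP => l _ <-; apply: cexp_neq0.
have natC_neq0 n : n.+1%:R != 0 :> R[i] by rewrite Num.Theory.pnatr_eq0.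
exists (@psi _ _ _ q_neq0 qa_neq0 q_not_root natC_neq0); split.
- by move=> A phi phi'; apply: psi_inj_subproof.
- exact: psi_map.
- exact: psi_determined.
Qed.
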